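(* Let $b\ge2$ be an integer. For every irrational $\gamma\in\mathbb R$, the sets $$E_{\gamma,b}=\{x\in\mathcal N_b:\ \gamma x\notin\mathcal N_b\},\qquad E_\gamma=\{x\in\mathcal N:\ \gamma x\notin\mathcal N\}$$ have Hausdorff dimension $1$ and Lebesgue measure zero.
   Context: For an integer base $b\ge2$ and $x\in\mathbb R$, use the canonical base-$b$ expansion of the fractional part of $x$ (choosing the terminating expansion when there are two choices). $x$ is $b$-normal if every finite word $w$ over $\{0,\dots,b-1\}$ occurs in this digit sequence with asymptotic frequency $b^{-|w|}$. $\mathcal N_b$ is the set of $b$-normal real numbers, and $\mathcal N=\bigcap_{b\ge2}\mathcal N_b$ is the set of absolutely normal numbers. *)

(* Defs.v *)
From HB Require Import structures.
From mathcomp Require Import all_boot all_order all_algebra.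
From mathcomp Require Import all_classical all_reals all_analysis.
Set Implicit Arguments.
Unset Strict Implicit.
Unset Printing Implicit Defensive.
Import Order.TTheory GRing.Theory Num.Theory.
Import numFieldNormedType.Exports.
Local Open Scope classical_set_scope.
Local Open Scope ring_scope.

Definition frac_part (R : realType) (x : R) : R := x - (Num.floor x)%:~R.

(* Positions are counted from 0: [digit b x n] is the coefficient of
   b ^ -(n+1).  Truncation yields the terminating expansion of b-adic
   rationals; see [digit_expansion]. *)
Definition digit (R : realType) (b : nat) (x : R) (n : nat) : nat :=
  (Num.truncn (frac_part x * b%:R ^+ n.+1) %% b)%N.

Definition occurs_at (R : realType) (b : nat) (x : R) (w : seq 'I_b)
    (i : nat) : bool :=
  [seq digit b x (i + j) | j <- iota 0 (size w)] == [seq val a | a <- w].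

Definition occurrences (R : realType) (b : nat) (x : R) (w : seq 'I_b)
    (N : nat) : nat :=
  count (occurs_at x w) (iota 0 N).

Definition normal (R : realType) (b : nat) : set R :=
  [set x | forall w : seq 'I_b,
    (fun N => (occurrences x w N)%:R / N%:R : R) @ \oo -->
      (b%:R ^- size w : R)].

Definition absolutely_normal (R : realType) : set R :=
  \bigcap_(b in [set b | (2 <= b)%N]) @normal R b.

Lemma frac_part_itv (R : realType) (x : R) : 0 <= frac_part x < 1.
Proof.
have /andP[x1 x2] := floor_itv x.
by rewrite /frac_part subr_ge0 x1 ltrBlDl -intrD1.
Qed.

Lemma ltn_digit (R : realType) (b : nat) (x : R) (n : nat) :
  (2 <= b)%N -> (digit b x n < b)%N.
Proof. by move=> b2; rewrite ltn_mod (leq_trans _ b2). Qed.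

Lemma sum_digit (R : realType) (b : nat) (x : R) (n : nat) : (2 <= b)%N ->
  \sum_(i < n) (digit b x i)%:R / b%:R ^+ i.+1 =
  (Num.truncn (frac_part x * b%:R ^+ n))%:R / b%:R ^+ n :> R.
Proof.
move=> b2; have b0 : (0 < b)%N by rewrite (leq_trans _ b2).
have bR0 : (0 : R) < b%:R by rewrite ltr0n.
have /andP[y0 y1] := frac_part_itv x.
elim: n => [|n IHn].
  rewrite big_ord0 expr0 mulr1 (_ : Num.truncn _ = 0%N) ?mul0r//.
  by apply: truncn_def; rewrite y0 y1.
rewrite big_ord_recr/= IHn /digit.
set z := frac_part x * b%:R ^+ n.
have z0 : 0 <= z by rewrite mulr_ge0// exprn_ge0// ltW.
have -> : frac_part x * b%:R ^+ n.+1 = b%:R * z.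
  by rewrite /z exprS mulrCA.
have zE : (Num.truncn (b%:R * z) %/ b)%N = Num.truncn z.
  have bz0 : 0 <= b%:R * z by rewrite mulr_ge0// ltW.
  have /andP[u1 u2] := truncn_itv z0.
  have /andP[v1 v2] := truncn_itv bz0.
  apply/eqP; rewrite eqn_leq; apply/andP; split.
    rewrite -ltnS ltn_divLR// -(ltr_nat R) (le_lt_trans v1)//.
    by rewrite natrM mulrC ltr_pM2r.
  rewrite leq_divRL// -ltnS -(ltr_nat R) (le_lt_trans _ v2)//.
  by rewrite natrM mulrC ler_pM2l.
rewrite [in RHS](divn_eq (Num.truncn (b%:R * z)) b) zE natrD natrM mulrDl.
by rewrite exprSr -mulf_div divff ?mulr1// gt_eqF.
Qed.

(* The strict upper bound, for all n, rules out an infinite tail of digits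
   b - 1. *)
Lemma digit_expansion (R : realType) (b : nat) (x : R) (n : nat) :
  (2 <= b)%N ->
  0 <= frac_part x - \sum_(i < n) (digit b x i)%:R / b%:R ^+ i.+1
    < (b%:R ^+ n)^-1.
Proof.
move=> b2; rewrite sum_digit//.
have b0 : (0 < b)%N by rewrite (leq_trans _ b2).
have bn0 : (0 : R) < b%:R ^+ n by rewrite exprn_gt0// ltr0n.
have /andP[y0 _] := frac_part_itv x.
have /andP[u1 u2] := truncn_itv (mulr_ge0 y0 (ltW bn0)).
rewrite subr_ge0 ler_pdivrMr// u1/= ltrBlDl -[X in _ + X]mul1r -mulrDl.
by rewrite ltr_pdivlMr// natr1.
Qed.

Local Open Scope ereal_scope.

(* The 0 only matters for the empty set, whose supremum would be -oo. *)
Definition diameter (R : realType) (U : set R) : \bar R :=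
  ereal_sup (0 |` [set `|p.1 - p.2|%:E | p in U `*` U]).

(* |U| ^ s, with the convention that the empty set contributes 0 even when
   s = 0. *)
Definition diameter_pow (R : realType) (s : R) (U : set R) : \bar R :=
  if U == set0 then 0 else poweR (diameter U) s.

Definition hausdorff_content (R : realType) (s delta : R) (A : set R)
    : \bar R :=
  ereal_inf [set \sum_(0 <= k <oo) diameter_pow s (U k) | U in
    [set U : (set R)^nat |
      A `<=` \bigcup_k U k /\ forall k, diameter (U k) <= delta%:E]].

Definition hausdorff_measure (R : realType) (s : R) (A : set R) : \bar R :=
  ereal_sup [set hausdorff_content s delta A | delta in
    [set delta : R | (0 < delta)%R]].

Definition hausdorff_dim (R : realType) (A : set R) : \bar R :=
  ereal_inf [set s%:E | s in
    [set s : R | (0 <= s)%R /\ hausdorff_measure s A = 0]].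

(* Main.v *)
Require Import Defs.
From mathcomp Require Import all_boot all_order all_algebra.
From mathcomp Require Import all_classical all_reals all_analysis.
From mathcomp Require Import measurable_realfun.
From mathcomp Require Import ring lra zify.
Set Implicit Arguments.
Unset Strict Implicit.
Unset Printing Implicit Defensive.
Import Order.TTheory GRing.Theory Num.Theory.
Import numFieldNormedType.Exports.
Local Open Scope classical_set_scope.
Local Open Scope ring_scope.

(** Both sets consist of numbers x such that gamma x is not absolutely normal,
    so the upper bounds follow from the normal number theorem of Borel: almost
    every real number is absolutely normal, hence so is gamma x for almost every
    x, and a Lebesgue-null set has zero one-dimensional Hausdorff measure
    ([hausdorff_measure1_negligible]).

    For the lower bound, fix s < 1 and put theta = 1 / gamma, B = b ^ (k + 1)
    and M = b ^ k with k large. Read the base-M digits of a uniform u in [0, 1)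
    as base-B digits of a number y ([respell]). In base b every (k + 1)-st digit
    of y is 0, so that the word 1 ... 1 of length k + 1 never occurs and y is
    not b-normal ([respell_not_normal]). The map y |-> u is Hoelder of exponent
    k / (k + 1) ([respell_holder]), so the image of a set of full measure of u
    has positive s-dimensional measure as soon as s <= k / (k + 1)
    ([hausdorff_measure_holder]). It remains to see that x = theta y, for which
    gamma x = y, is absolutely normal for almost every u. The same assertion
    with M = B, where y is u itself, and with gamma in place of theta is the
    part of Borel's theorem that the upper bound needs. It is proved for all
    irrational theta at once ([absolutely_normal_ae]).

    By the criterion of Weyl ([normal_of_mean0]) one has to show that, for every
    base a and every integer h > 0, the averages over n < N of cos (2 pi h a^n x)
    tend to 0, almost surely. Let B^i be the largest power of B that is at most
    a^n. The n-th term essentially depends on the digits of y up to the index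
    i + K', for a constant K'; subtract its conditional expectation given the
    digits up to i - K. Two such differences are orthogonal once their indices
    are a constant apart, so their averages tend to 0 almost surely, by
    Chebyshev's inequality along the squares ([fluct_ae]). The conditional
    expectation itself is at most a product of K factors, the moduli of the
    Fourier transform of a uniform digit at the points s_n B^j, j < K, where
    s_n = h theta a^n / B^i ([cond_avg_damp]). A factor is bounded away from 1
    unless its point is close to an integer.

    What is left is arithmetic: for large K the mean over n of these products
    is small ([damp_mean_small]). A long run of indices j at which s_n B^j stays
    close to an integer puts s_n extremely close to a rational number with
    denominator B^J, and there are finitely many of these in the range of the
    s_n. If a and B have a common power then s_n takes finitely many values,
    all irrational, and such runs do not exist. Otherwise any two mantissas
    a^n / B^i with nearby indices n are separated, so that s_n comes back close
    to a given rational number only after a long time. No far_rate of convergence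
    enters this argument, so the irrationality of gamma suffices for it. *)

(** * Attenuation at points far from the integers *)

Definition nint (R : realType) (t : R) : int := Num.floor (t + 2^-1).

Lemma nint_dist (R : realType) (t : R) : `|t - (nint t)%:~R| <= 2^-1.
Proof.
have /andP[h1 h2] := floor_itv (t + 2^-1).
rewrite /nint; move: h2; rewrite intrD => h2.
by rewrite ler_norml; apply/andP; split; lra.
Qed.

Lemma int_close (R : realType) (m n : int) :
  `|m%:~R - n%:~R : R| < 1 -> m = n.
Proof.
rewrite -intrB -intr_norm -[1]/(1%:~R) ltr_int => h; lia.
Qed.

(** Multiplication by B carries a point this close to an integer to a point
    less than 1/2 - margin away from an integer: see [margin_mul]. *)
Definition margin (R : realType) (B : nat) : R := (2 * B%:R + 2)^-1.

Lemma margin_gt0 (R : realType) (B : nat) : 0 < margin R B.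
Proof. by rewrite invr_gt0 ltr_wpDl// mulr_ge0. Qed.

Definition near_int (R : realType) (B : nat) (t : R) : bool :=
  `|t - (nint t)%:~R| < margin R B.

Lemma margin_mul (R : realType) (B : nat) : (B%:R + 1) * margin R B = 2^-1.
Proof.
have B1 : B%:R + 1 != 0 :> R by rewrite gt_eqF// ltr_wpDl.
have -> : margin R B = (2 * (B%:R + 1))^-1 by rewrite /margin; congr (_^-1); ring.
by rewrite invfM mulrCA divff ?mulr1.
Qed.

(** Being close to an integer before and after multiplication by B leaves no
    room for the nearest integer to change by anything but the factor B. *)
Lemma nintM (R : realType) (B : nat) (t : R) :
  near_int B t -> near_int B (t * B%:R) ->
  nint (t * B%:R) = (nint t * B%:Z)%R.
Proof.
move=> h1 h2; apply: (@int_close R).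
rewrite intrM.
have e : `|(nint t)%:~R * B%:R - t * B%:R| <= margin R B * B%:R :> R.
  by rewrite -mulrBl normrM distrC [X in _ * X]ger0_norm// ler_wpM2r// ltW.
have -> : (nint (t * B%:R))%:~R - (nint t)%:~R * B%:R =
  ((nint (t * B%:R))%:~R - t * B%:R) - ((nint t)%:~R * B%:R - t * B%:R) :> R.
  by ring.
apply: le_lt_trans (ler_normB _ _) _.
rewrite distrC; have mm := margin_mul R B.
have := h2; rewrite /near_int => h3; lra.
Qed.

(** The distance to the nearest integer is multiplied by B at each step of the
    run and is still less than 1 at its end. *)
Lemma near_int_run (R : realType) (B : nat) (t : R) (k : nat) :
  (forall i, (i <= k)%N -> near_int B (t * B%:R ^+ i)) ->
  `|t - (nint t)%:~R| * B%:R ^+ k < 1.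
Proof.
move=> h; have hk : nint (t * B%:R ^+ k) = (nint t * B%:Z ^+ k)%R.
  elim: k h => [|k IH] h; first by rewrite !expr0 !mulr1.
  rewrite exprSr mulrA nintM ?h//.
    by rewrite IH ?exprSr ?mulrA// => i ik; apply: h; rewrite leqW.
  by rewrite -mulrA -exprSr h.
have := h k (leqnn k); rewrite /near_int hk intrM rmorphXn/=.
rewrite -mulrBl normrM [X in _ * X]ger0_norm ?exprn_ge0// => /lt_le_trans; apply.
rewrite invf_le1; last by rewrite ltr_wpDl// mulr_ge0.
have : 0 <= B%:R :> R by []. lra.
Qed.

(** An upper bound for the modulus of the Fourier transform at t of a digit
    uniform in {0, ..., M - 1}, which keeps only the interference of the digits
    0 and 1: see [norm_avg_wave_le]. *)
Definition attenuation (R : realType) (M : nat) (t : R) : R :=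
  1 - 2 / M%:R * (1 - `|cos (pi * t)|).

Section attenuation.
Variables (R : realType) (M : nat).
Hypothesis M2 : (2 <= M)%N.

Let M_inv : 0 < 2 / M%:R :> R.
Proof. by rewrite divr_gt0// ltr0n; lia. Qed.

Let M_inv1 : 2 / M%:R <= 1 :> R.
Proof. by rewrite ler_pdivrMr ?mul1r ?ler_nat// ltr0n; lia. Qed.

Lemma attenuation_ge0 (t : R) : 0 <= attenuation M t.
Proof.
rewrite /attenuation.
set x := `|_|; have : x <= 1 by exact: cos_max.
have : 0 <= x by exact: normr_ge0.
by have := M_inv; have := M_inv1; nra.
Qed.

Lemma attenuation_le1 (t : R) : attenuation M t <= 1.
Proof.
rewrite /attenuation.
set x := `|_|; have : x <= 1 by exact: cos_max.
by have := M_inv; have := M_inv1; nra.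
Qed.

Definition far_rate (B : nat) : R := attenuation M (margin R B).

Lemma margin_le (B : nat) : margin R B <= 2^-1.
Proof.
have B0 : 0 <= B%:R :> R by [].
by rewrite lef_pV2 ?posrE//; lra.
Qed.

Lemma norm_cos_int (t : R) (m : int) : `|cos (pi * (t + m%:~R))| = `|cos (pi * t)|.
Proof.
have N k (s : R) : `|cos (pi * (s + k%:R))| = `|cos (pi * s)|.
  elim: k => [|k IH]; first by rewrite addr0.
  by rewrite -natr1 addrA mulrDr mulr1 cosDpi normrN IH.
case: m => k; first exact: N.
rewrite NegzE -(N k.+1 (t + _)); congr (`|cos (pi * _)|).
by rewrite -addrA mulrNz addNr addr0.
Qed.

(** The cosine is even and decreasing on [0, pi / 2], and an integer shift
    brings t into [-1/2, 1/2]. *)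
Lemma attenuation_far (B : nat) (t : R) : ~~ near_int B t ->
  attenuation M t <= far_rate B.
Proof.
rewrite -leNgt => h; rewrite /far_rate /attenuation lerD2l lerN2 ler_pM2l//.
rewrite lerD2l lerN2.
rewrite -(subrK (nint t)%:~R t) norm_cos_int.
have p0 := pi_gt0 R.
have d := nint_dist t.
have m0 := margin_gt0 R B; have m1 := margin_le B.
rewrite -(cos_norm (_ * (_ - _))) normrM (gtr0_norm p0).
set x := `|t - _| in h d *.
rewrite ger0_norm; last first.
  by apply: cos_ge0_pihalf; apply/andP; split; nra.
rewrite ger0_norm; last first.
  by apply: cos_ge0_pihalf; apply/andP; split; nra.
rewrite leNgt ltr_cos.
- by rewrite -leNgt ler_pM2l.
- by rewrite in_itv/=; apply/andP; split; nra.
- by rewrite in_itv/=; apply/andP; split; nra.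
Qed.

Lemma far_rate_lt1 (B : nat) : far_rate B < 1.
Proof.
rewrite /far_rate /attenuation.
have p0 := pi_gt0 R.
have m0 := margin_gt0 R B; have m1 := margin_le B.
have : `|cos (pi * margin R B)| < 1.
  rewrite ger0_norm; last first.
    by apply: cos_ge0_pihalf; apply/andP; split; nra.
  rewrite -(@cos0 R) ltr_cos ?mulr_gt0//.
  - by rewrite in_itv/= lexx ltW.
  - by rewrite in_itv/=; apply/andP; split; nra.
by have := M_inv; nra.
Qed.

Definition damp (B K : nat) (s : R) : R :=
  \prod_(i < K) attenuation M (s * B%:R ^+ i).

Lemma damp_ge0 B K s : 0 <= damp B K s.
Proof. by apply: prodr_ge0 => i _; exact: attenuation_ge0. Qed.

Lemma damp_le1 B K s : damp B K s <= 1.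
Proof.
apply: (le_trans (@ler_prod _ _ _ _ _ (fun=> 1) _)).
  by move=> i _; rewrite attenuation_ge0 attenuation_le1.
by rewrite prodr_const expr1n.
Qed.

(** Either some factor among the k new ones is at most [far_rate], or all the k
    new points are close to integers; damp being at most 1, the latter costs at
    most 1. *)
Lemma damp_step B K k s :
  damp B (K + k) s <= far_rate B * damp B K s +
    [forall i : 'I_k, near_int B (s * B%:R ^+ (K + i))]%:R.
Proof.
have dKk : damp B (K + k) s =
    damp B K s * \prod_(i < k) attenuation M (s * B%:R ^+ (K + i)).
  by rewrite /damp big_split_ord.
case: (boolP [forall i : 'I_k, _]) => [_|/forallPn[i /= ni]].
  apply: le_trans (damp_le1 _ _ _) _.
  by rewrite lerDr mulr_ge0 ?attenuation_ge0 ?damp_ge0.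
rewrite addr0 dKk mulrC ler_wpM2r ?damp_ge0//.
rewrite (bigD1 i)//= -[leRHS]mulr1 ler_pM ?attenuation_ge0//.
- by apply: prodr_ge0 => j _; exact: attenuation_ge0.
- exact: attenuation_far.
apply: (le_trans (@ler_prod _ _ _ _ _ (fun=> 1) _)).
  by move=> j _; rewrite attenuation_ge0 attenuation_le1.
by rewrite prodr_const expr1n.
Qed.

End attenuation.

(** * Mantissas of powers, and rarity of long runs close to the integers *)

Section mantissa.
Variables (R : realType) (a B : nat).
Hypotheses (a2 : (2 <= a)%N) (B2 : (2 <= B)%N).

Definition exponent (n : nat) : nat := trunc_log B (a ^ n).

Definition mantissa (n : nat) : R := a%:R ^+ n / B%:R ^+ exponent n.

Let a0 : (0 < a)%N. Proof. by lia. Qed.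
Let B0 : (0 < B)%N. Proof. by lia. Qed.
Let aR : 0 < a%:R :> R. Proof. by rewrite ltr0n. Qed.
Let BR : 0 < B%:R :> R. Proof. by rewrite ltr0n. Qed.

Lemma exponent_bounds n : (B ^ exponent n <= a ^ n < B ^ (exponent n).+1)%N.
Proof. by apply: trunc_log_bounds => //; rewrite expn_gt0 a0. Qed.

Lemma mantissa_ge1 n : 1 <= mantissa n.
Proof.
have /andP[h _] := exponent_bounds n.
by rewrite /mantissa ler_pdivlMr ?exprn_gt0// mul1r -!natrX ler_nat.
Qed.

Lemma mantissa_lt n : mantissa n < B%:R.
Proof.
have /andP[_ h] := exponent_bounds n.
by rewrite /mantissa ltr_pdivrMr ?exprn_gt0// -exprS -!natrX ltr_nat.
Qed.

Lemma exponent_le m n : (m <= n)%N -> (exponent m <= exponent n)%N.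
Proof. by move=> mn; rewrite leq_trunc_log// leq_pexp2l. Qed.

(** The quotient of the two mantissas is a^k / B^j with j bounded in terms of k.
    It is not 1, so the integers a^k and B^j differ by at least 1. *)
Lemma mantissa_gap k n : (forall j, a ^ k != B ^ j)%N ->
  (a ^ k * B)%:R ^-1 <= `|mantissa (n + k) - mantissa n|.
Proof.
move=> indep.
have sle : (exponent n <= exponent (n + k))%N by rewrite exponent_le// leq_addr.
set j := (exponent (n + k) - exponent n)%N.
have sE : exponent (n + k) = (exponent n + j)%N by rewrite subnKC.
have lE : mantissa (n + k) = mantissa n * (a%:R ^+ k / B%:R ^+ j).
  by rewrite /mantissa sE !exprD; field; rewrite !gt_eqF ?exprn_gt0.
have ak : 0 < a%:R ^+ k :> R by rewrite exprn_gt0.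
have Bj : 0 < B%:R ^+ j :> R by rewrite exprn_gt0.
have l1 := mantissa_ge1 n; have lB := mantissa_lt n; have l1' := mantissa_ge1 (n + k).
have BjaB : B%:R ^+ j < (a ^ k * B)%:R :> R.
  rewrite natrM natrX; move: l1'; rewrite lE mulrA ler_pdivlMr// mul1r.
  by move=> /le_lt_trans; apply; rewrite mulrC ltr_pM2l.
have one : 1 <= `|a%:R ^+ k - B%:R ^+ j : R|.
  have := indep j; rewrite -!natrX.
  move: (a ^ k)%N (B ^ j)%N => x y xy.
  have : `|x%:Z - y%:Z| >= 1 by lia.
  by rewrite -(ler_int R) intr_norm intrB.
have -> : mantissa (n + k) - mantissa n =
    mantissa n * ((a%:R ^+ k - B%:R ^+ j) / B%:R ^+ j).
  by rewrite lE; field; rewrite gt_eqF.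
rewrite normrM (normrM (_ - _)) (gtr0_norm (lt_le_trans ltr01 l1)) normfV (gtr0_norm Bj).
apply: (@le_trans _ _ (B%:R ^+ j)^-1).
  by rewrite lef_pV2 ?ltW// posrE// ltr0n muln_gt0 expn_gt0 a0.
have Bi : 0 < (B%:R ^+ j)^-1 :> R by rewrite invr_gt0.
rewrite mulrA -[leLHS]mul1r ler_wpM2r ?(ltW Bi)//.
exact: mulr_ege1.
Qed.

Lemma mantissa_periodic k j : (a ^ k = B ^ j)%N -> forall n, mantissa (n + k) = mantissa n.
Proof.
move=> kj n.
have sE : exponent (n + k) = (exponent n + j)%N.
  apply: trunc_log_eq => //; rewrite -addSn !expnD kj.
  by rewrite leq_pmul2r ?ltn_pmul2r ?exponent_bounds// expn_gt0 B0.
rewrite /mantissa sE !exprD -!natrX kj; field.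
by rewrite !gt_eqF// ltr0n expn_gt0 B0.
Qed.

End mantissa.

(** The values th * mantissa n are irrational, even after multiplication by
    powers of B. *)
Lemma irrationalM_rat (R : realType) (th : R) (p q : nat) (m : int) (r : nat) :
  irrational th -> (0 < p)%N -> (0 < q)%N -> (0 < r)%N ->
  th * (p%:R / q%:R) * r%:R = m%:~R -> False.
Proof.
move=> irr p0 q0 r0 E; apply: irr; apply/rationalP.
exists (m * q%:Z)%R, (p * r)%N.
have pR : p%:R != 0 :> R by rewrite pnatr_eq0 -lt0n.
have qR : q%:R != 0 :> R by rewrite pnatr_eq0 -lt0n.
have rR : r%:R != 0 :> R by rewrite pnatr_eq0 -lt0n.
by rewrite natrM intrM -E -pmulrn; field; rewrite pR qR rR.
Qed.

Lemma count_windows (P : pred nat) (T C N : nat) : (0 < T)%N ->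
  (forall n, count P (iota n T) <= C)%N ->
  (count P (iota 0 N) <= C * (N %/ T).+1)%N.
Proof.
move=> T0 h.
have H q n : (count P (iota n (q * T)) <= C * q)%N.
  elim: q n => [|q IH] n; first by rewrite mul0n.
  by rewrite mulSn iotaD count_cat mulnS leq_add.
apply: leq_trans (H _ 0%N).
have NT : (N <= (N %/ T).+1 * T)%N by rewrite ltnW// ltn_ceil.
by rewrite -(subnKC NT) iotaD count_cat leq_addr.
Qed.

Section rare.
Variables (R : realType) (a B : nat) (th : R).
Hypotheses (a2 : (2 <= a)%N) (B2 : (2 <= B)%N) (irr : irrational th).

Let s n : R := th * mantissa R a B n.
Let bad J k n := [forall i : 'I_k, near_int B (s n * B%:R ^+ (J + i))].

Let a0 : (0 < a)%N. Proof. by lia. Qed.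
Let B0 : (0 < B)%N. Proof. by lia. Qed.
Let BR : 0 < B%:R :> R. Proof. by rewrite ltr0n. Qed.

Let bad_close J k n : bad J k.+1 n ->
  `|s n * B%:R ^+ J - (nint (s n * B%:R ^+ J))%:~R| < B%:R ^- k.
Proof.
move=> /forallP h; rewrite -[ltRHS]mul1r ltr_pdivlMr ?exprn_gt0//.
apply: near_int_run => i ik; rewrite -mulrA -exprD.
by apply: (h (Ordinal (_ : i < k.+1)%N)).
Qed.

Let small_pow (e : R) : 0 < e -> exists k, B%:R ^- k < e.
Proof.
move=> e0; have [k hk] : exists k : nat, e^-1 < k%:R.
  by exists (Num.truncn e^-1).+1; exact: truncnS_gt.
exists k; rewrite invf_plt ?posrE ?exprn_gt0//.
apply: (lt_le_trans hk); rewrite -natrX ler_nat ltnW//.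
by apply: ltn_expl.
Qed.

(** When a and B have a common power the mantissas are periodic, so the points
    s n take finitely many values, none of which is a rational number. *)
Lemma near_int_runs_dependent J k0 j : (0 < k0)%N -> (a ^ k0 = B ^ j)%N ->
  exists k, forall n, ~~ bad J k n.
Proof.
move=> k00 kj.
have lper n : mantissa R a B n = mantissa R a B (n %% k0).
  rewrite {1}(divn_eq n k0); elim: (n %/ k0)%N => [|q IH]; first by rewrite add0n.
  by rewrite mulSn -addnA addnC (mantissa_periodic R a2 B2 kj).
have H r : exists k, ~~ bad J k.+1 r.
  (* A run of length k + 1 would bring s r * B ^ J within B ^ - k of an integer. *)
  set d := `|s r * B%:R ^+ J - (nint (s r * B%:R ^+ J))%:~R|.
  have d0 : 0 < d.
    rewrite normr_gt0 subr_eq0; apply/eqP => E.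
    move: E; rewrite /s /mantissa -!natrX => E.
    by apply: (irrationalM_rat irr _ _ _ E); rewrite ?expn_gt0 ?a0 ?B0.
  have [k hk] := small_pow d0.
  by exists k; apply/negP => /bad_close/(lt_trans hk); rewrite ltxx.
have /choice[f hf] := H.
exists (\max_(r < k0) (f r).+1)%N => n.
have := hf (n %% k0)%N; apply: contra => /forallP h.
have kk : (f (n %% k0)%N < \max_(r < k0) (f r).+1)%N.
  apply: (@leq_trans (f (Ordinal (ltn_pmod n k00))).+1) => //.
  exact: (leq_bigmax (Ordinal (ltn_pmod n k00))).
apply/forallP => i; have := h (Ordinal (leq_trans (ltn_ord i) kk)).
by rewrite /= /s lper.
Qed.

(** Within a window of T indices, distinct bad indices have distinct nearest
    integers, because equal nearest integers would force two mantissas closer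
    than [mantissa_gap] allows. The bound C on the number of these integers does
    not depend on T, so long windows make the density C / T small. *)
Lemma near_int_runs_independent J : (forall k j, (0 < k)%N -> (a ^ k != B ^ j)%N) ->
  exists C, forall T, exists k, forall n, (count (bad J k) (iota n T) <= C)%N.
Proof.
move=> indep.
have th0 : 0 < `|th|.
  rewrite normr_gt0; apply/eqP => th0; apply: irr; exists 0 => //.
  by rewrite th0 rmorph0.
(* All the nearest integers that occur are less than A in absolute value. *)
pose A := (Num.truncn (`|th| * B%:R ^+ J.+1)).+2.
have nintA n : (`|nint (s n * B%:R ^+ J)| < A%:Z)%R.
  rewrite -(ltr_int R) intr_norm.
  have := nint_dist (s n * B%:R ^+ J).
  have sB : `|s n * B%:R ^+ J| <= `|th| * B%:R ^+ J.+1.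
    have lB := mantissa_lt R a2 B2 n; have l1 := mantissa_ge1 R a2 B2 n.
    have l0 : 0 <= mantissa R a B n by rewrite (le_trans _ l1).
    rewrite /s exprS mulrA normrM (normrM th) (ger0_norm l0) [X in _ * X]ger0_norm ?exprn_ge0//.
    by rewrite ler_wpM2r ?exprn_ge0// ler_wpM2l// ltW.
  have := truncnS_gt (`|th| * B%:R ^+ J.+1).
  rewrite -pmulrn (_ : A%:R = (Num.truncn (`|th| * B%:R ^+ J.+1)).+1%:R + 1) ?natr1//.
  set m := (nint _)%:~R; set t := s n * _ in sB *; set z := _ * _ in sB *.
  move=> h1 h2; have := ler_normB t (t - m).
  rewrite opprB addrC subrK => h3. lra.
exists (A + A)%N => T.
have e0 : 0 < `|th| / (2 * (a ^ T * B)%:R).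
  by rewrite divr_gt0// mulr_gt0// ltr0n muln_gt0 expn_gt0 a0.
(* This k makes 2 B ^ - k smaller than the least distance, multiplied by |th|,
   of two mantissas whose indices differ by less than T. *)
have [k hk] := small_pow e0.
exists k.+1 => n.
have inj : {in seq.filter (bad J k.+1) (iota n T) &,
    injective (fun x => nint (s x * B%:R ^+ J))}.
  suff H x d : (0 < d < T)%N -> bad J k.+1 x -> bad J k.+1 (x + d) ->
      nint (s x * B%:R ^+ J) = nint (s (x + d)%N * B%:R ^+ J) -> False.
    move=> x y; rewrite !mem_filter !mem_iota => /andP[bx ix] /andP[hy iy] xy.
    case: (ltngtP x y) => // hxy; exfalso.
      apply: (H x (y - x)%N) => //; rewrite ?subnKC ?(ltnW hxy)//.
      by move: ix iy hxy; clear; lia.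
    apply: (H y (x - y)%N) => //; rewrite ?subnKC ?(ltnW hxy)//.
    by move: ix iy hxy; clear; lia.
  move=> /andP[d0 dT] /bad_close b1 /bad_close b2 E.
  have g := mantissa_gap R a2 B2 x (indep d ^~ d0).
  have BJ : 1 <= B%:R ^+ J :> R by rewrite -natrX ler1n expn_gt0 B0.
  have adT : (a ^ T * B)%:R^-1 <= (a ^ d * B)%:R^-1 :> R.
    rewrite lef_pV2 ?posrE ?ltr0n ?muln_gt0 ?expn_gt0 ?a0// ler_nat.
    by rewrite leq_pmul2r// leq_pexp2l// ltnW.
  have : `|(s (x + d)%N - s x) * B%:R ^+ J| < 2 * B%:R ^- k.
    rewrite mulrBl.
    rewrite -E in b2.
    move: b1 b2; move: (nint _)%:~R => m.
    move: (s x * _) (s (x + d)%N * _) => p q b1 b2.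
    have -> : q - p = (q - m) - (p - m) by ring.
    apply: le_lt_trans (ler_normB _ _) _; lra.
  rewrite /s -mulrBr normrM (normrM th) [X in _ * X]ger0_norm ?exprn_ge0//.
  apply/negP; rewrite -leNgt.
  apply: (@le_trans _ _ (`|th| * (a ^ T * B)%:R^-1)).
    move: hk; rewrite invfM mulrCA; lra.
  rewrite -[leLHS]mulr1 ler_pM// ?mulr_ge0// ?invr_ge0//.
  by rewrite ler_wpM2l// (le_trans adT).
rewrite -size_filter -(size_map (fun x => nint (s x * B%:R ^+ J))).
have -> : (A + A)%N = size [seq i%:Z - A%:Z | i <- iota 0 (A + A)]%R.
  by rewrite size_map size_iota.
apply: uniq_leq_size.
  by rewrite map_inj_in_uniq// filter_uniq// iota_uniq.
move=> m /mapP[x _ ->]; have := nintA x; move: (nint _) => z hz.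
apply/mapP; exists (absz (z + A%:Z)%R); last by lia.
by rewrite mem_iota; lia.
Qed.

Lemma near_int_runs_rare J (e : R) : 0 < e -> exists k N0, forall N, (N0 <= N)%N ->
  (count (bad J k) (iota 0 N))%:R <= e * N%:R.
Proof.
move=> e0.
have [[k0 [j [k00 kj]]]|indep] :
    (exists k j, (0 < k)%N /\ (a ^ k = B ^ j)%N) \/
    (forall k j, (0 < k)%N -> (a ^ k != B ^ j)%N).
  have [h|h] := pselect (exists k j, (0 < k)%N /\ (a ^ k = B ^ j)%N); first by left.
  by right => k j k0; apply/eqP => kj; apply: h; exists k, j.
- have [k hk] := near_int_runs_dependent J k00 kj; exists k, 0%N => N _.
  rewrite (eq_count (_ : _ =1 pred0)) ?count_pred0 ?mulr_ge0// 1?ltW//.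
  by move=> n; apply/negbTE/hk.
have [C hC] := near_int_runs_independent J indep.
(* C / T <= e / 2; the last window, which may be incomplete, adds at most C. *)
pose T := (Num.truncn (2 * C%:R / e)).+1.
have [k hk] := hC T.
exists k, (Num.truncn (2 * C%:R / e)).+1 => N hN.
have T0' : (0 < T)%N by [].
have hT : 2 * C%:R / e < T%:R by exact: truncnS_gt.
have hN' : 2 * C%:R / e < N%:R by apply: lt_le_trans hT _; rewrite ler_nat.
clearbody T; have := count_windows N T0' hk; rewrite -(ler_nat R) => /le_trans; apply.
move: hT hN'; rewrite !ltr_pdivrMr// => hT hN'.
have : (N %/ T * T)%:R <= N%:R :> R by rewrite ler_nat leq_divM.
rewrite !natrM -[(_ %/ _).+1%:R]natr1 mulrDr mulr1 => qT.
have T0 : 0 < T%:R :> R by rewrite ltr0n.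
have : C%:R * (N %/ T)%:R <= e * N%:R / 2; last by lra.
have q0 : 0 <= (N %/ T)%:R :> R by [].
nra.
Qed.

Variable M : nat.
Hypothesis M2 : (2 <= M)%N.

(** Apply [damp_step] repeatedly, each time with k so large that the bad indices
    are rare: the mean is multiplied by [far_rate] up to a small error. *)
Lemma damp_mean_small (e : R) : 0 < e -> exists K N0, forall N, (N0 <= N)%N ->
  \sum_(0 <= n < N) damp M B K (s n) <= e * N%:R.
Proof.
move=> e0.
have r1 := far_rate_lt1 R M2 B; have r0 : 0 <= far_rate R M B by exact: attenuation_ge0.
have H r : exists K N0, forall N, (N0 <= N)%N ->
    \sum_(0 <= n < N) damp M B K (s n) <= (far_rate R M B ^+ r + e / 2) * N%:R.
  elim: r => [|r [K [N0 IH]]].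
    exists 0%N, 0%N => N _.
    apply: (@le_trans _ _ (\sum_(0 <= n < N) 1)).
      by apply: ler_sum => i _; exact: damp_le1.
    rewrite sumr_const_nat subn0 -[leLHS]mul1r ler_wpM2r// expr0 lerDl.
    by rewrite divr_ge0// ltW.
  (* With this error e / 2 is the fixed point of the recursion for the mean. *)
  have e'0 : 0 < (1 - far_rate R M B) * (e / 2) by rewrite mulr_gt0 ?subr_gt0// divr_gt0.
  have [k [N1 h]] := near_int_runs_rare K e'0.
  exists (K + k)%N, (maxn N0 N1) => N; rewrite geq_max => /andP[/IH hN0 /h hN1].
  apply: (@le_trans _ _ (\sum_(0 <= n < N)
      (far_rate R M B * damp M B K (s n) + (bad K k n)%:R))).
    by apply: ler_sum => i _; exact: damp_step.
  rewrite big_split/= -mulr_sumr.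
  have -> : \sum_(0 <= n < N) (bad K k n)%:R = (count (bad K k) (iota 0 N))%:R :> R.
    rewrite -sum1_count natr_sum [RHS]big_mkcond /index_iota subn0.
    by apply: eq_bigr => i _; case: (bad _ _ _).
  move: hN0 hN1; set S := \sum_(_ <= _ < _) _; set c := (count _ _)%:R => hN0 hN1.
  have := ler_wpM2l r0 hN0; rewrite exprS; nra.
have [r hr] : exists r, far_rate R M B ^+ r < e / 2.
  have := @cvg_expr R (far_rate R M B); rewrite ger0_norm// => /(_ r1).
  move=> /cvgrPdist_lt/(_ (e / 2)); rewrite divr_gt0// => /(_ isT)[r _ /(_ r)].
  by move=> /(_ (leqnn _)); rewrite sub0r normrN ger0_norm ?exprn_ge0//; exists r.
have [K [N0 h]] := H r; exists K, N0 => N /h /le_trans; apply.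
by rewrite ler_wpM2r//; lra.
Qed.
End rare.

(** * Averages over random digits *)

Section avg.
Variables (R : realType) (M : nat).

(** The expectation of f over words of p independent digits, uniform in
    {0, ..., M - 1}. Recursion on the first digit makes conditioning on an
    initial segment the lemma [avg_cat]. *)
Fixpoint avg (p : nat) (f : seq nat -> R) : R :=
  if p is p'.+1
  then (\sum_(0 <= d < M) avg p' (fun w => f (d :: w))) / M%:R
  else f [::].

Lemma eq_avg p f g : (forall w, size w = p -> f w = g w) -> avg p f = avg p g.
Proof.
elim: p f g => [|p IH] f g fg /=; first exact: fg.
congr (_ / _); apply: eq_bigr => d _; apply: IH => w wp.
by apply: fg; rewrite /= wp.
Qed.

Lemma avgD p f g : avg p (fun w => f w + g w) = avg p f + avg p g.
Proof.
elim: p f g => [|p IH] f g //=.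
by rewrite -mulrDl -big_split/=; congr (_ / _); apply: eq_bigr => d _.
Qed.

Lemma avgZ p k f : avg p (fun w => k * f w) = k * avg p f.
Proof.
elim: p f => [|p IH] f //=.
by rewrite mulrA mulr_sumr; congr (_ / _); apply: eq_bigr => d _.
Qed.

Lemma avgB p f g : avg p (fun w => f w - g w) = avg p f - avg p g.
Proof.
rewrite -mulN1r -avgZ -avgD; apply: eq_avg => w _.
by rewrite mulN1r.
Qed.

Lemma avg_sum p (I : Type) (r : seq I) (f : I -> seq nat -> R) :
  avg p (fun w => \sum_(i <- r) f i w) = \sum_(i <- r) avg p (f i).
Proof.
elim: r => [|i r IH].
  rewrite big_nil -[RHS](mul0r (avg p (fun=> 0))) -avgZ; apply: eq_avg => w _.
  by rewrite big_nil mul0r.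
rewrite big_cons -IH -avgD; apply: eq_avg => w _.
by rewrite big_cons.
Qed.

Lemma avg_cat p q f :
  avg (p + q) f = avg p (fun w => avg q (fun v => f (w ++ v))).
Proof.
elim: p f => [|p IH] f //=.
by congr (_ / _); apply: eq_bigr => d _; exact: IH.
Qed.

Lemma ler_avg p f g : (forall w, size w = p -> f w <= g w) -> avg p f <= avg p g.
Proof.
elim: p f g => [|p IH] f g fg /=; first exact: fg.
rewrite ler_wpM2r ?invr_ge0//; apply: ler_sum => d _; apply: IH => w wp.
by apply: fg; rewrite /= wp.
Qed.

Lemma avg_cst p (k : R) : (0 < M)%N -> avg p (fun=> k) = k.
Proof.
move=> M0; elim: p => [|p IH] //=.
rewrite IH sumr_const_nat subn0 -[k *+ M]mulr_natr mulfK// pnatr_eq0; lia.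
Qed.

Lemma ler_norm_avg p f k : (0 < M)%N -> (forall w, size w = p -> `|f w| <= k) ->
  `|avg p f| <= k.
Proof.
move=> M0 fk; rewrite ler_norml -{1}(avg_cst p (- k) M0) -{2}(avg_cst p k M0).
by apply/andP; split; apply: ler_avg => w /fk; rewrite ler_norml => /andP[].
Qed.
End avg.

Definition wave (R : realType) (t : R) : R := cos (2 * pi * t).

(** The number 0.w written in base B. *)
Fixpoint value (R : realType) (B : nat) (w : seq nat) : R :=
  if w is d :: w' then (d%:R + value R B w') / B%:R else 0.

Lemma value_cat (R : realType) (B : nat) (w v : seq nat) :
  value R B (w ++ v) = value R B w + value R B v / B%:R ^+ size w.
Proof.
elim: w => [|d w IH] /=; first by rewrite add0r divr1.
by rewrite IH exprS invfM; ring.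
Qed.

Lemma norm_wave (R : realType) (t : R) : `|wave t| <= 1.
Proof. exact: cos_max. Qed.

Lemma wave_add (R : realType) (t d : R) :
  wave t + wave (t + d) = 2 * cos (pi * d) * wave (t + d / 2).
Proof.
rewrite /wave.
have -> : 2 * pi * t = 2 * pi * (t + d / 2) - pi * d by field.
have -> : 2 * pi * (t + d) = 2 * pi * (t + d / 2) + pi * d by field.
by rewrite cosB cosD; ring.
Qed.

(** The mean value theorem for the cosine. *)
Lemma wave_lip (R : realType) (s t : R) : `|wave s - wave t| <= 2 * pi * `|s - t|.
Proof.
have H (x y : R) : x < y -> `|cos y - cos x| <= y - x.
  move=> xy.
  have D z : z \in `]x, y[%R -> is_derive z 1 cos (- sin z) by move=> _; exact: is_derive_cos.
  have cc : {within `[x, y], continuous cos}.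
    by apply: continuous_subspaceT => z; exact: continuous_cos.
  have [z _ ->] := MVT xy D cc.
  have yx : 0 < y - x by rewrite subr_gt0.
  by rewrite normrM normrN (gtr0_norm yx) ler_piMl ?(ltW yx)// sin_max.
have p0 : 0 < 2 * pi :> R by rewrite mulr_gt0// pi_gt0.
rewrite /wave -[X in X * `|_|](gtr0_norm p0) -normrM mulrBr.
case: (ltgtP (2 * pi * s) (2 * pi * t)) => [h|h|->]; last by rewrite !subrr.
- by rewrite distrC [leRHS]distrC (le_trans (H _ _ h))// ler_norm.
- by rewrite (le_trans (H _ _ h))// ler_norm.
Qed.

(** Condition on the first digit d, which shifts the phase by d eta / B: the
    terms for d = 0 and d = 1 combine to a wave multiplied by
    2 cos (pi eta / B), and the others are bounded by their absolute values. *)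
Lemma norm_avg_wave_le (R : realType) (M B p : nat) (eta beta : R) : (2 <= M)%N ->
  `|avg M p (fun w => wave (eta * value R B w + beta))| <=
  \prod_(j < p) attenuation M (eta / B%:R ^+ j.+1).
Proof.
move=> M2; elim: p eta beta => [|p IH] eta beta /=.
  by rewrite big_ord0 norm_wave.
set D := \prod_(j < p) attenuation M (eta / B%:R / B%:R ^+ j.+1).
have -> : \prod_(j < p.+1) attenuation M (eta / B%:R ^+ j.+1) =
    attenuation M (eta / B%:R) * D.
  rewrite big_ord_recl expr1; congr (_ * _); apply: eq_bigr => j _.
  by rewrite -mulrA -invfM -exprS.
pose A d := avg M p (fun w => wave ((eta / B%:R) * value R B w + (beta + d%:R * (eta / B%:R)))).
have -> : \sum_(0 <= d < M) avg M p
    (fun w => wave (eta * ((d%:R + value R B w) / B%:R) + beta)) =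
    \sum_(0 <= d < M) A d.
  by apply: eq_bigr => d _; apply: eq_avg => w _; congr wave; ring.
have D0 : 0 <= D by apply: prodr_ge0 => j _; exact: attenuation_ge0.
(* The factor by which the digits 0 and 1 interfere. *)
have A01 : `|A 0%N + A 1%N| <= 2 * `|cos (pi * (eta / B%:R))| * D.
  rewrite /A -avgD.
  rewrite (_ : avg M p _ = avg M p (fun w => 2 * cos (pi * (eta / B%:R)) *
    wave ((eta / B%:R) * value R B w + (beta + (eta / B%:R) / 2)))); last first.
    apply: eq_avg => w _; rewrite mul0r addr0 mul1r !addrA wave_add.
    by [].
  rewrite avgZ normrM normrM (ger0_norm (_ : 0 <= 2))//.
  by rewrite ler_wpM2l ?mulr_ge0.
have -> : \sum_(0 <= d < M) A d = A 0%N + A 1%N + \sum_(2 <= d < M) A d.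
  by rewrite big_ltn ?(leq_trans _ M2)// big_ltn// addrA.
have A2 : `|\sum_(2 <= d < M) A d| <= (M%:R - 2) * D.
  apply: le_trans (ler_norm_sum _ _ _) _.
  apply: (@le_trans _ _ (\sum_(2 <= d < M) D)).
    by apply: ler_sum => d _; exact: IH.
  by rewrite sumr_const_nat -natrB// mulr_natl.
have MR : 0 < M%:R :> R by rewrite ltr0n (leq_trans _ M2).
rewrite normrM normfV (ger0_norm (ltW MR)) ler_pdivrMr//.
apply: le_trans (ler_normD _ _) _.
apply: le_trans (lerD A01 A2) _.
rewrite /attenuation le_eqVlt; apply/orP; left; apply/eqP.
by field; rewrite gt_eqF.
Qed.

Section variance.
Variables (R : realType) (M : nat) (F : nat -> seq nat -> R) (l p : nat -> nat).
Variable c : nat.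
Hypotheses (M0 : (0 < M)%N) (F1 : forall n w, `|F n w| <= 1).
Hypotheses (lp : forall n, (l n <= p n)%N).
Hypothesis gap : forall m n, (m + c <= n)%N -> (p m <= l n)%N.

(** The conditional expectation of F n, a function of the first p n digits,
    given the first l n digits. *)
Definition cond_avg n w := avg M (p n - l n) (fun v => F n (take (l n) w ++ v)).

Definition fluct n w := F n (take (p n) w) - cond_avg n w.

Lemma norm_fluct n w : `|fluct n w| <= 2.
Proof.
apply: le_trans (ler_normB _ _) _.
by rewrite (_ : 2 = 1 + 1)// lerD// ler_norm_avg.
Qed.

(** The earlier fluctuation is determined by the first l n digits, given which
    the later one has mean zero. *)
Lemma fluct_orthogonal P m n : (m + c <= n)%N -> (p n <= P)%N ->
  avg M P (fun w => fluct m w * fluct n w) = 0.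
Proof.
move=> mn nP; have pl := gap mn.
have -> : P = (l n + ((p n - l n) + (P - p n)))%N.
  by rewrite addnA subnKC// subnKC.
rewrite avg_cat -[RHS](avg_cst (l n) 0 M0); apply: eq_avg => w1 s1.
rewrite avg_cat.
have tk k v : (k <= l n)%N -> take k (w1 ++ v) = take k w1.
  move=> kl; rewrite take_cat s1; case: ltngtP kl => // -> _.
  by rewrite subnn take0 cats0 take_oversize// s1.
have Zm v : fluct m (w1 ++ v) = fluct m w1.
  by rewrite /fluct /cond_avg !tk// (leq_trans (lp m)).
rewrite (@eq_avg _ _ _ _ (fun w2 => fluct m w1 *
    (F n (w1 ++ w2) - cond_avg n w1))); last first.
  move=> w2 s2; rewrite -[RHS](avg_cst (P - p n) _ M0); apply: eq_avg => w3 s3.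
  rewrite Zm; congr (_ * _); rewrite /fluct /cond_avg !(tk (l n))//.
  congr (F n _ - _).
  by rewrite catA take_size_cat// size_cat s1 s2 subnKC.
rewrite avgZ avgB avg_cst// /cond_avg take_oversize ?s1//.
by rewrite subrr mulr0.
Qed.

Lemma fluct_variance P N : (forall n, (n < N)%N -> (p n <= P)%N) ->
  avg M P (fun w => (\sum_(0 <= n < N) fluct n w) ^+ 2) <= (8 * c * N)%:R.
Proof.
move=> NP.
have -> : avg M P (fun w => (\sum_(0 <= n < N) fluct n w) ^+ 2) =
    \sum_(0 <= n < N) \sum_(0 <= m < N) avg M P (fun w => fluct m w * fluct n w).
  under eq_bigr do rewrite -avg_sum.
  rewrite -avg_sum; apply: eq_avg => w _.
  by rewrite expr2 mulr_sumr; apply: eq_bigr => n _; rewrite mulr_suml.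
(* Each n has at most 2 c indices m with a nonzero covariance, at most 4. *)
pose near n := [pred m | (m < n + c)%N && (n < m + c)%N].
apply: (@le_trans _ _ (\sum_(0 <= n < N) (4 * (2 * c))%:R)); last first.
  by rewrite sumr_const_nat subn0 -mulrnA ler_nat; lia.
apply: ler_sum_nat => n /andP[_ nN].
apply: (@le_trans _ _ (\sum_(0 <= m < N) 4 * (near n m)%:R)).
  apply: ler_sum_nat => m /andP[_ mN].
  case: (boolP (near n m)) => [_|].
    apply: le_trans (ler_norm _) _; rewrite mulr1; apply: ler_norm_avg => // w _.
    rewrite normrM (_ : 4 = 2 * 2) ?ler_pM ?norm_fluct//.
    by rewrite -natrM.
  rewrite /near /= negb_and -!leqNgt => /orP[h|h].
    by rewrite (@eq_avg _ _ _ _ (fun w => fluct n w * fluct m w)) ?fluct_orthogonal ?NP ?mulr_ge0//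
      => w _; rewrite mulrC.
  by rewrite fluct_orthogonal ?NP ?mulr_ge0.
rewrite -mulr_sumr natrM ler_wpM2l//.
have -> : \sum_(0 <= m < N) (near n m)%:R = (count (near n) (iota 0 N))%:R :> R.
  rewrite -sum1_count natr_sum [RHS]big_mkcond /index_iota subn0.
  by apply: eq_bigr => m _; case: (near n m).
rewrite ler_nat -size_filter -(size_iota (n - c) (2 * c)).
apply: uniq_leq_size; first by rewrite filter_uniq// iota_uniq.
move=> m; rewrite mem_filter !mem_iota /near /=; lia.
Qed.

(** The inequality of Chebyshev. *)
Lemma fluct_deviation P N (eta : R) : 0 < eta -> (0 < N)%N ->
  (forall n, (n < N)%N -> (p n <= P)%N) ->
  avg M P (fun w => (eta * N%:R <= `|\sum_(0 <= n < N) fluct n w|)%R%:R) <=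
  (8 * c)%:R / (eta ^+ 2 * N%:R).
Proof.
move=> eta0 N0 NP; have NR : 0 < N%:R :> R by rewrite ltr0n.
have e2 : 0 < (eta * N%:R) ^+ 2 by rewrite exprn_gt0// mulr_gt0.
rewrite (_ : _ / _ = (8 * c * N)%:R / (eta * N%:R) ^+ 2); last first.
  by rewrite (natrM _ (8 * c)); field; rewrite !gt_eqF.
apply: (@le_trans _ _ (avg M P (fun w =>
    ((eta * N%:R) ^+ 2)^-1 * (\sum_(0 <= n < N) fluct n w) ^+ 2))).
  apply: ler_avg => w _; case: (leP (eta * N%:R)) => h; last first.
    by rewrite mulr_ge0 ?invr_ge0 ?sqr_ge0.
  rewrite mulrC ler_pdivlMr// mul1r -[leRHS]real_normK ?num_real//.
  by rewrite ler_sqr ?nnegrE// mulr_ge0// ltW.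
by rewrite avgZ mulrC ler_wpM2r ?invr_ge0 ?(ltW e2)// fluct_variance.
Qed.
End variance.

(** * Cesaro means and the Fejer kernel *)

(** Convergence to zero of the arithmetic means of f, as a bound on sums. *)
Definition mean0 (R : realType) (f : nat -> R) : Prop :=
  forall e : R, 0 < e -> exists N0, forall N, (N0 <= N)%N ->
    `|\sum_(0 <= n < N) f n| <= e * N%:R.

Lemma mean0_ext (R : realType) (f g : nat -> R) : f =1 g -> mean0 f -> mean0 g.
Proof.
move=> fg h e /h[N0 H]; exists N0 => N /H.
by rewrite (eq_bigr g).
Qed.

Lemma mean0D (R : realType) (f g : nat -> R) :
  mean0 f -> mean0 g -> mean0 (fun n => f n + g n).
Proof.
move=> hf hg e e0; have e2 : 0 < e / 2 by rewrite divr_gt0.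
have [N1 h1] := hf _ e2; have [N2 h2] := hg _ e2.
exists (maxn N1 N2) => N; rewrite geq_max => /andP[/h1 H1 /h2 H2].
rewrite big_split/=; apply: le_trans (ler_normD _ _) _; lra.
Qed.

Lemma mean0Z (R : realType) (k : R) (f : nat -> R) :
  mean0 f -> mean0 (fun n => k * f n).
Proof.
move=> hf e e0; have k0 : 0 < `|k| + 1 by rewrite ltr_wpDl.
have [N1 h1] := hf _ (divr_gt0 e0 k0).
exists N1 => N /h1 H1; rewrite -mulr_sumr normrM.
move: H1; rewrite mulrAC ler_pdivlMr// mulrDr mulr1 mulrC.
have := normr_ge0 (\sum_(0 <= n < N) f n); lra.
Qed.

Lemma mean0_sum (R : realType) (I : Type) (r : seq I) (P : pred I)
    (f : I -> nat -> R) :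
  (forall i, P i -> mean0 (f i)) -> mean0 (fun n => \sum_(i <- r | P i) f i n).
Proof.
move=> h; elim: r => [|i r IH].
  move=> e e0; exists 0%N => N _; rewrite big1 ?normr0 ?mulr_ge0// 1?ltW//.
  by move=> n _; rewrite big_nil.
case: (boolP (P i)) => Pi.
  by apply: mean0_ext (mean0D (h i Pi) IH) => n; rewrite big_cons Pi.
by apply: mean0_ext IH => n; rewrite big_cons (negbTE Pi).
Qed.

Section kernel.
Variable R : realType.
Implicit Types t d : R.

Lemma waveN t : wave (- t) = wave t.
Proof. by rewrite /wave mulrN cosN. Qed.

Lemma wave0 : wave 0 = 1 :> R.
Proof. by rewrite /wave mulr0 cos0. Qed.

Lemma wave_int t (m : int) : wave (t + m%:~R) = wave t.
Proof.
have N k (s : R) : wave (s + k%:R) = wave s.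
  elim: k => [|k IH]; first by rewrite addr0.
  rewrite -IH /wave -[k.+1%:R]natr1.
  have -> : 2 * pi * (s + (k%:R + 1)) = 2 * pi * (s + k%:R) + pi *+ 2 by ring.
  by rewrite cosD2pi.
case: m => k; first exact: N.
rewrite NegzE -(N k.+1 (t + _)); congr (wave _).
by rewrite -addrA mulrNz addNr addr0.
Qed.

(** Twice sin (pi d) times each wave is the difference of two consecutive
    values of a sine. *)
Lemma telescope_wave d t Q :
  2 * sin (pi * d) * \sum_(0 <= k < Q) wave (t + k%:R * d) =
  sin (2 * pi * (t + Q%:R * d) - pi * d) - sin (2 * pi * t - pi * d).
Proof.
elim: Q => [|Q IH]; first by rewrite big_nil mulr0 mul0r addr0 subrr.
rewrite big_nat_recr//= mulrDr IH /wave -[Q.+1%:R]natr1.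
have -> : 2 * pi * (t + (Q%:R + 1) * d) - pi * d =
  2 * pi * (t + Q%:R * d) + pi * d by ring.
set A := 2 * pi * (t + Q%:R * d).
by rewrite (sinD A (pi * d)) (sinB A); ring.
Qed.

Lemma norm_sum_wave d t Q :
  `|sin (pi * d)| * `|\sum_(0 <= k < Q) wave (t + k%:R * d)| <= 1.
Proof.
have := telescope_wave d t Q.
move/(congr1 Num.norm); rewrite 2!normrM (ger0_norm (_ : 0 <= 2))// => h.
have : 2 * `|sin (pi * d)| * `|\sum_(0 <= k < Q) wave (t + k%:R * d)| <= 2.
  rewrite h; apply: le_trans (ler_normB _ _) _.
  by rewrite (_ : 2 = 1 + 1)// lerD// sin_max.
lra.
Qed.

Variable Q : nat.
Hypothesis Q0 : (0 < Q)%N.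
Let QR : 0 < Q%:R :> R. Proof. by rewrite ltr0n. Qed.

(** The kernel of Fejer, that is the squared modulus of the sum of
    exp (2 pi i j t) over j < Q, divided by Q. The phase -1/4 turns the cosine
    into a sine. *)
Definition fejer t : R :=
  ((\sum_(0 <= j < Q) wave (0 + j%:R * t)) ^+ 2 +
   (\sum_(0 <= j < Q) wave (- 4^-1 + j%:R * t)) ^+ 2) / Q%:R.

Lemma fejer_ge0 t : 0 <= fejer t.
Proof. by rewrite divr_ge0// addr_ge0// sqr_ge0. Qed.

Lemma fejer_le t (s : R) : 0 < s -> s <= `|sin (pi * t)| ->
  fejer t <= 2 / (s ^+ 2 * Q%:R).
Proof.
move=> s0 hs.
have H u : (\sum_(0 <= j < Q) wave (u + j%:R * t)) ^+ 2 <= (s ^+ 2)^-1.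
  have := norm_sum_wave t u Q; set S := \sum_(_ <= _ < _) _ => h.
  rewrite -[leLHS]real_normK ?num_real// -[leRHS]mul1r ler_pdivlMr ?exprn_gt0//.
  rewrite -exprMn expr_le1 ?mulr_ge0 ?(ltW s0)//.
  by apply: le_trans h; rewrite mulrC ler_wpM2r.
rewrite /fejer [leRHS](_ : _ = ((s ^+ 2)^-1 + (s ^+ 2)^-1) / Q%:R).
  by rewrite ler_wpM2r ?invr_ge0// lerD.
by field; rewrite !gt_eqF.
Qed.

Lemma fejerE t : fejer t =
  (\sum_(0 <= j < Q) \sum_(0 <= l < Q) wave ((j%:R - l%:R) * t)) / Q%:R.
Proof.
rewrite /fejer; congr (_ / _).
rewrite 2!expr2 2!mulr_suml -big_split/=; apply: eq_bigr => j _.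
rewrite 2!mulr_sumr -big_split/=; apply: eq_bigr => l _.
have W u : wave (- 4^-1 + u) = sin (2 * pi * u).
  by rewrite /wave -cosBpihalf; congr cos; field.
by rewrite !W !add0r /wave mulrBl mulrBr cosB.
Qed.

Lemma fejer_int t (m : int) : fejer (t + m%:~R) = fejer t.
Proof.
rewrite !fejerE; congr (_ / _); apply: eq_bigr => j _; apply: eq_bigr => l _.
rewrite mulrDr (_ : (j%:R - l%:R) * m%:~R = ((j%:Z - l%:Z) * m)%:~R) ?wave_int//.
by rewrite intrM intrB.
Qed.

(** The frequencies j - l in [fejerE] are less than Q in absolute value, so the
    sum over the Q equidistant nodes kills all of them but the frequency 0. *)
Lemma sum_fejer t : \sum_(0 <= k < Q) fejer (t - k%:R / Q%:R) = Q%:R.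
Proof.
under eq_bigr do rewrite fejerE.
rewrite -mulr_suml exchange_big/=.
under eq_bigr do rewrite exchange_big/=.
rewrite (_ : \sum_(0 <= j < Q) _ = \sum_(0 <= j < Q) Q%:R); last first.
  apply: eq_big_nat => j /andP[_ jQ].
  rewrite (bigD1_seq j) ?mem_index_iota ?jQ ?iota_uniq//=.
  rewrite [X in X + _](_ : _ = Q%:R); last first.
    under eq_bigr do rewrite subrr mul0r wave0.
    by rewrite sumr_const_nat subn0.
  rewrite big_seq_cond big1 ?addr0// => l; rewrite mem_index_iota => /andP[lQ lj].
  set d : R := - ((j%:R - l%:R) / Q%:R).
  rewrite (eq_bigr (fun k => wave ((j%:R - l%:R) * t + k%:R * d))); last first.
    by move=> k _; congr wave; rewrite /d; ring.
  have := telescope_wave d ((j%:R - l%:R) * t) Q.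
  rewrite (_ : Q%:R * d = - (j%:Z - l%:Z)%:~R); last first.
    by rewrite /d intrB; field; rewrite gt_eqF.
  have -> (u v : R) (m : int) : sin (2 * pi * (u + - m%:~R) - v) = sin (2 * pi * u - v).
    have pi0 : pi != 0 :> R by rewrite gt_eqF// pi_gt0.
    rewrite -!cosBpihalf.
    have E w : cos (w : R) = wave (w / (2 * pi)).
      by rewrite /wave mulrCA divff ?mulr1// gt_eqF// mulr_gt0// pi_gt0.
    rewrite 2!E -[LHS](wave_int _ m); congr wave.
    by move: pi pi0 => q q0; field.
  rewrite subrr => /eqP; rewrite mulf_eq0 => /orP[|/eqP//].
  rewrite mulf_eq0 pnatr_eq0/= => /eqP sd; exfalso.
  suff : 0 < `|sin (pi * d)| by rewrite sd normr0 ltxx.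
  have sN v : `|sin (v : R)| = `|sin `|v| |.
    by case: (lerP 0 v) => [/ger0_norm ->//|/ltr0_norm ->]; rewrite sinN normrN.
  rewrite sN normrM (gtr0_norm (pi_gt0 R)) normrN normrM normfV (gtr0_norm QR).
  have jl0 : 0 < `|j%:R - l%:R : R|.
    by rewrite normr_gt0 subr_eq0 eqr_nat eq_sym.
  have jlQ : `|j%:R - l%:R : R| < Q%:R.
    rewrite -[j%:R]/(j%:Z%:~R) -[l%:R]/(l%:Z%:~R) -[Q%:R]/(Q%:Z%:~R).
    rewrite -intrB -intr_norm ltr_int; lia.
  rewrite normr_gt0 gt_eqF// sin_gt0_pi// mulr_gt0 ?pi_gt0 ?divr_gt0//=.
  by rewrite -[ltRHS]mulr1 ltr_pM2l ?pi_gt0// ltr_pdivrMr// mul1r.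
by rewrite sumr_const_nat subn0 -[Q%:R *+ Q]mulr_natr mulfK// gt_eqF.
Qed.

End kernel.

(** * The criterion of Weyl for intervals *)

(** The constant term of the kernel is 1, and its other terms are waves of
    nonzero integral frequency. *)
Lemma mean0_fejer (R : realType) (z : nat -> R) (Q : nat) (t : R) : (0 < Q)%N ->
  (forall (h : nat) (beta : R), (0 < h)%N ->
     mean0 (fun n => wave (h%:R * z n + beta))) ->
  mean0 (fun n => fejer Q (z n - t) - 1).
Proof.
move=> Q0 hz; have QR : Q%:R != 0 :> R by rewrite pnatr_eq0 -lt0n.
have H : mean0 (fun n => \sum_(0 <= j < Q) \sum_(0 <= l < Q | l != j)
    wave ((j%:R - l%:R) * (z n - t))).
  apply: mean0_sum => j _; apply: mean0_sum => l lj.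
  case: (ltngtP l j) lj => // lj _.
    apply: mean0_ext (hz (j - l)%N (- ((j%:R - l%:R) * t)) _); last by rewrite subn_gt0.
    by move=> n; rewrite natrB 1?ltnW// mulrBr.
  apply: mean0_ext (hz (l - j)%N ((j%:R - l%:R) * t) _); last by rewrite subn_gt0.
  by move=> n; rewrite -waveN natrB 1?ltnW//; congr wave; ring.
apply: mean0_ext (mean0Z Q%:R^-1 H) => n.
rewrite fejerE mulrC.
suff -> : \sum_(0 <= j < Q) \sum_(0 <= l < Q) wave ((j%:R - l%:R) * (z n - t)) =
   \sum_(0 <= j < Q) \sum_(0 <= l < Q | l != j) wave ((j%:R - l%:R) * (z n - t)) + Q%:R.
  by field.
rewrite [X in _ = _ + X](_ : Q%:R = \sum_(0 <= j < Q) (1 : R)); last first.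
  by rewrite sumr_const_nat subn0.
rewrite -big_split/=; apply: eq_big_nat => j /andP[_ jQ].
rewrite (bigD1_seq j) ?mem_index_iota ?jQ ?iota_uniq//=.
by rewrite subrr mul0r wave0 addrC.
Qed.

Lemma sin_ge (R : realType) (rho x : R) : 0 < rho -> rho <= `|x| <= 1 - rho ->
  sin (pi * rho) <= `|sin (pi * x)|.
Proof.
move=> r0 /andP[x1 x2].
have p0 := pi_gt0 R.
have -> : `|sin (pi * x)| = `|sin (pi * `|x|)|.
  case: (lerP 0 x) => [/ger0_norm -> //|/ltr0_norm ->].
  by rewrite mulrN sinN normrN.
move: (`|x|) x1 x2 => y y1 y2.
apply: le_trans (ler_norm _).
rewrite -!cosBpihalf -(cos_norm (_ - _)) -[leRHS]cos_norm.
have -> : `|pi * rho - pi / 2| = pi / 2 - pi * rho.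
  by rewrite distrC ger0_norm// subr_ge0; nra.
have h : `|pi * y - pi / 2| <= pi / 2 - pi * rho.
  by rewrite ler_norml; apply/andP; split; nra.
rewrite leNgt ltr_cos ?in_itv/=.
- by rewrite -leNgt.
- by apply/andP; split; nra.
- by rewrite normr_ge0/=; apply: le_trans h _; nra.
Qed.

Lemma frac_partE (R : realType) (x : R) : x = frac_part x + (Num.floor x)%:~R.
Proof. by rewrite /frac_part subrK. Qed.

(** Add up Fejer kernels over nodes in the interval [A / L, (A + 1) / L) that
    stay away from its ends. The sum is at most 1 everywhere and almost 0
    outside the interval, while its mean along z is the density of the nodes.
    Lower bounds for all the intervals imply upper bounds, and working inside
    [0, 1) in this way avoids wrapping intervals around the circle. *)
Lemma weyl_lower (R : realType) (z : nat -> R) (L A : nat) (e : R) :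
  (forall (h : nat) (beta : R), (0 < h)%N ->
     mean0 (fun n => wave (h%:R * z n + beta))) ->
  (A < L)%N -> 0 < e ->
  exists N0, forall N, (N0 <= N)%N ->
    (L%:R^-1 - e) * N%:R <=
    \sum_(0 <= n < N) (A%:R / L%:R <= frac_part (z n) < A.+1%:R / L%:R)%R%:R.
Proof.
move=> hz AL e0; have L0 : (0 < L)%N by exact: leq_ltn_trans AL.
have LR : 0 < L%:R :> R by rewrite ltr0n.
(* Giving up a fraction 1 / m of the interval at either end costs 2 / (L m). *)
have [m m2 hm] : exists2 m : nat, (2 < m)%N & 2 / (L%:R * m%:R) <= e / 3.
  exists (Num.truncn (6 / e)).+3 => //.
  have h : 6 / e < (Num.truncn (6 / e)).+3%:R.
    by apply: lt_le_trans (truncnS_gt _) _; rewrite ler_nat !ltnS leqW.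
  move: ((Num.truncn (6 / e)).+3%:R) h => m; rewrite ltr_pdivrMr// => h.
  have L1 : 1 <= L%:R :> R by rewrite ler1n.
  have m0 : 0 < m by rewrite -(pmulr_lgt0 _ e0); lra.
  rewrite ler_pdivrMr ?mulr_gt0//; nra.
pose rho : R := (L%:R * m%:R)^-1.
have mR : 2 < m%:R :> R by rewrite ltr_nat.
have rho0 : 0 < rho by rewrite invr_gt0 mulr_gt0// (lt_trans _ mR).
pose sg := sin (pi * rho).
have sg0 : 0 < sg.
  rewrite sin_gt0_pi// mulr_gt0 ?pi_gt0//= -[ltRHS]mulr1 ltr_pM2l ?pi_gt0//.
  rewrite invf_lt1 ?mulr_gt0 ?(lt_trans _ mR)// -natrM ltr1n.
  by rewrite (leq_trans (ltnW m2))// leq_pmull.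
(* At distance at least rho from the nodes the Fejer kernel is O(1 / s). *)
have [s s0 hs] : exists2 s : nat, (0 < s)%N &
    2 / (sg ^+ 2 * (L * m * s)%:R) <= e / 3.
  exists (Num.truncn (6 / (sg ^+ 2 * e))).+1 => //.
  have := truncnS_gt (6 / (sg ^+ 2 * e)).
  have sg2 : 0 < sg ^+ 2 by rewrite exprn_gt0.
  move: (Num.truncn _) => s; rewrite ltr_pdivrMr ?mulr_gt0// => h.
  have Lm1 : 1 <= (L * m)%:R :> R by rewrite ler1n muln_gt0 L0 (ltn_trans _ m2).
  rewrite ler_pdivrMr; last by rewrite mulr_gt0// natrM mulr_gt0// (lt_le_trans _ Lm1).
  have h' : 2 <= e / 3 * (sg ^+ 2 * s.+1%:R) by nra.
  apply: le_trans h' _; rewrite ler_wpM2l ?divr_ge0 ?(ltW e0)// ler_wpM2l ?(ltW sg2)//.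
  by rewrite natrM ler_peMl.
have mn0 : m%:R != 0 :> R by rewrite pnatr_eq0 -lt0n (ltn_trans _ m2).
have sn0 : s%:R != 0 :> R by rewrite pnatr_eq0 -lt0n.
have Ln0 : L%:R != 0 :> R by rewrite pnatr_eq0 -lt0n.
pose Q := (L * m * s)%N.
have Q0 : (0 < Q)%N by rewrite !muln_gt0 L0 s0 (ltn_trans _ m2).
have QR : 0 < Q%:R :> R by rewrite ltr0n.
(* The nodes k / Q with lo <= k < hi are at distance at least rho = s / Q from
   both ends of the interval. *)
pose lo := ((A * m + 1) * s)%N; pose hi := ((A.+1 * m - 1) * s)%N.
have lohi : (lo <= hi)%N by rewrite leq_mul2r mulSn; apply/orP; right; clear -m2; lia.
have hiQ : (hi <= Q)%N.
  rewrite leq_mul2r; apply/orP; right; rewrite leq_subLR (leq_trans _ (leq_addl _ _))//.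
  by rewrite leq_mul2r AL orbT.
pose T (t : R) := (\sum_(lo <= k < hi) fejer Q (t - k%:R / Q%:R)) / Q%:R.
have T1 (t : R) : T t <= 1.
  rewrite ler_pdivrMr// mul1r -[leRHS](sum_fejer Q0 t).
  rewrite (@big_cat_nat _ _ _ lo 0%N Q)/= ?(leq_trans lohi)//.
  rewrite (@big_cat_nat _ _ _ hi lo Q)//=.
  rewrite addrCA lerDl addr_ge0//; by apply: sumr_ge0 => k _; exact: fejer_ge0.
have Tfar z' : ~~ (A%:R / L%:R <= frac_part z' < A.+1%:R / L%:R) -> T z' <= e / 3.
  move=> far; apply: le_trans hs; rewrite -/Q.
  rewrite ler_pdivrMr//.
  apply: (@le_trans _ _ (\sum_(lo <= k < hi) 2 / (sg ^+ 2 * Q%:R))); last first.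
    rewrite sumr_const_nat -[leLHS]mulr_natr ler_wpM2l ?divr_ge0 ?mulr_ge0 ?exprn_ge0 ?(ltW sg0)//.
    by rewrite ler_nat (leq_trans (leq_subr _ _)).
  apply: ler_sum_nat => k /andP[lok khi].
  rewrite [in leLHS](frac_partE z') addrAC fejer_int.
  apply: fejer_le => //; apply: sin_ge => //.
  have k1 : A%:R / L%:R + rho <= k%:R / Q%:R.
    rewrite (_ : _ + rho = lo%:R / Q%:R) ?ler_wpM2r ?invr_ge0 ?ler_nat//.
    rewrite /lo /Q /rho !natrM natrD natrM; field.
    by rewrite ?mn0 ?sn0 ?Ln0.
  have k2 : k%:R / Q%:R <= A.+1%:R / L%:R - rho.
    rewrite (_ : _ - rho = hi%:R / Q%:R) ?ler_wpM2r ?invr_ge0 ?ler_nat 1?ltnW//.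
    rewrite /hi /Q /rho !natrM natrB ?natrM ?muln_gt0 ?(ltn_trans _ m2)//; field.
    by rewrite ?mn0 ?sn0 ?Ln0.
  have /andP[y0 y1] := frac_part_itv z'.
  have A0 : 0 <= A%:R / L%:R :> R by rewrite divr_ge0.
  have A1 : A.+1%:R / L%:R <= 1 :> R by rewrite ler_pdivrMr// mul1r ler_nat.
  have rL : A%:R / L%:R + rho <= 1 - rho by lra.
  move: far; rewrite negb_and -ltNge -leNgt => /orP[far|far].
    rewrite ltr0_norm ?subr_lt0; first by apply/andP; split; lra.
    lra.
  rewrite ger0_norm ?subr_ge0; first by apply/andP; split; lra.
  lra.
have Hsum : mean0 (fun n => Q%:R^-1 * \sum_(lo <= k < hi) (fejer Q (z n - k%:R / Q%:R) - 1)).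
  by apply: mean0Z; apply: mean0_sum => k _; exact: mean0_fejer.
have e3 : 0 < e / 3 by rewrite divr_gt0.
have [N0 hN0] := Hsum _ e3.
exists N0 => N /hN0; rewrite ler_norml => /andP[+ _].
have -> : \sum_(0 <= n < N) Q%:R^-1 * \sum_(lo <= k < hi) (fejer Q (z n - k%:R / Q%:R) - 1)
   = \sum_(0 <= n < N) (T (z n) - (hi - lo)%:R / Q%:R).
  apply: eq_bigr => n _; rewrite big_split/= mulrDr mulrC; congr (_ + _).
  by rewrite sumrN sumr_const_nat mulrN mulrC.
rewrite big_split/= sumr_const_nat subn0.
have -> : (hi - lo)%:R / Q%:R = L%:R^-1 - 2 * rho.
  rewrite -mulnBl (_ : _ - _ = m - 2)%N; last by clear -m2; rewrite mulSn; lia.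
  rewrite /Q /rho !natrM natrB 1?ltnW//; field.
  by rewrite ?mn0 ?sn0 ?Ln0.
have : \sum_(0 <= n < N) T (z n) <= \sum_(0 <= n < N)
    ((A%:R / L%:R <= frac_part (z n) < A.+1%:R / L%:R)%R%:R + e / 3).
  apply: ler_sum => n _; case: (boolP (_ <= _ < _)) => [_|/Tfar far]; last by rewrite add0r.
  by rewrite (le_trans (T1 _))// lerDl ltW.
rewrite big_split/= sumr_const_nat subn0.
rewrite -[(- _) *+ N]mulr_natr -[(e / 3) *+ N]mulr_natr.
move: hm; rewrite -/rho => hm h1 h2.
have N_ge0 : 0 <= N%:R :> R by [].
move: h1 h2; set X := \sum_(_ <= _ < _) _; set Y := \sum_(_ <= _ < _) _ => h1 h2.
have := ler_wpM2r N_ge0 hm; lra.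
Qed.

(** * Digits, words and intervals *)

Section words.
Variables (R : realType) (b : nat).
Hypothesis b2 : (2 <= b)%N.
Let b0 : (0 < b)%N. Proof. exact: leq_trans b2. Qed.
Let bR : 0 < b%:R :> R. Proof. by rewrite ltr0n. Qed.

Definition prefix_digits (u : R) (p : nat) : seq nat :=
  [seq digit b u j | j <- iota 0 p].

Lemma size_prefix_digits u p : size (prefix_digits u p) = p.
Proof. by rewrite size_map size_iota. Qed.

Lemma prefix_digits_lt u p : all (gtn b) (prefix_digits u p).
Proof. by apply/allP => d /mapP[j _ ->]; exact: ltn_digit. Qed.

Lemma prefix_digitsS u p : prefix_digits u p.+1 = prefix_digits u p ++ [:: digit b u p].
Proof. by rewrite /prefix_digits -addn1 iotaD map_cat. Qed.

Lemma value_prefix_digits u p : 0 <= frac_part u - value R b (prefix_digits u p) < b%:R ^- p.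
Proof.
suff -> : value R b (prefix_digits u p) =
    \sum_(i < p) (digit b u i)%:R / b%:R ^+ i.+1 by exact: digit_expansion.
elim: p => [|p IH]; first by rewrite big_ord0.
rewrite prefix_digitsS value_cat IH big_ord_recr/= size_prefix_digits addr0.
by rewrite -mulrA -invfM -exprS.
Qed.

Lemma value_nat (w : seq nat) : all (gtn b) w ->
  exists2 A, (A < b ^ size w)%N & value R b w = A%:R / b%:R ^+ size w.
Proof.
elim: w => [|d w IH] /=; first by exists 0%N; rewrite // mul0r.
move=> /andP[db /IH[A Aw ->]]; exists (d * b ^ size w + A)%N.
  rewrite expnS (@leq_trans (d.+1 * b ^ size w))//; first by rewrite mulSn addnC ltn_add2r.
  by rewrite leq_mul2r db orbT.
by rewrite natrD natrM natrX exprS; field; rewrite ?gt_eqF ?exprn_gt0.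
Qed.

Lemma value_itv (w : seq nat) : all (gtn b) w -> 0 <= value R b w < 1.
Proof.
move=> /value_nat[A Aw ->]; rewrite divr_ge0//= ltr_pdivrMr ?exprn_gt0// mul1r.
by rewrite -natrX ltr_nat.
Qed.

(** The first digit is recovered as an integral part, since what follows it has
    value in [0, 1). *)
Lemma value_inj (w v : seq nat) : size w = size v ->
  all (gtn b) w -> all (gtn b) v -> value R b w = value R b v -> w = v.
Proof.
elim: w v => [|d w IH] [|d' v]//= [wv] /andP[db wb] /andP[d'b vb].
move=> /(congr1 ( *%R^~ b%:R)); rewrite !divfK ?gt_eqF// => E.
have /andP[w0 w1] := value_itv wb; have /andP[v0 v1] := value_itv vb.
have dd : d = d'.
  apply: (can_inj (@natrK R)) => /=.
  case: (ltngtP d d') => [h|h|->//]; exfalso.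
    have : d%:R + 1 <= d'%:R :> R by rewrite natr1 ler_nat.
    lra.
  have : d'%:R + 1 <= d%:R :> R by rewrite natr1 ler_nat.
  lra.
by rewrite dd (IH v)//; move: E; rewrite dd => /addrI.
Qed.

(** The value of the word w and that of the digits of t are both multiples of
    b ^ - size w within this distance of the fractional part of t. *)
Lemma prefix_digits_itv (t : R) (w : seq nat) : all (gtn b) w ->
  value R b w <= frac_part t < value R b w + b%:R ^- size w ->
  prefix_digits t (size w) = w.
Proof.
move=> wb /andP[t0 t1]; apply: value_inj; rewrite ?size_prefix_digits ?prefix_digits_lt//.
have := value_prefix_digits t (size w).
have [A _ ->] := value_nat (prefix_digits_lt t (size w)).
move: t0 t1; have [A' _ ->] := value_nat wb; rewrite size_prefix_digits.
have bw : 0 < b%:R ^+ size w :> R by rewrite exprn_gt0.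
have q0 : 0 <= b%:R ^- size w :> R by rewrite invr_ge0 ltW.
have S (m n : nat) : (m < n)%N ->
    m%:R / b%:R ^+ size w + b%:R ^- size w <= n%:R / b%:R ^+ size w :> R.
  by move=> mn; rewrite -[X in _ + X]mul1r -mulrDl natr1 ler_wpM2r// ler_nat.
move=> t0 t1 /andP[s0 s1]; case: (ltngtP A A') => [/S h|/S h|->//]; exfalso; lra.
Qed.

(** The fractional parts of x, multiplied by b^i, and of b^i x differ by a
    natural number, which becomes a multiple of b when the digit is read. *)
Lemma digit_shift (x : R) i j : digit b x (i + j) = digit b (b%:R ^+ i * x) j.
Proof.
have [y0 y1] := andP (frac_part_itv x).
have [K HK] : exists K : nat, frac_part x * b%:R ^+ i = frac_part (b%:R ^+ i * x) + K%:R.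
  set m := (Num.floor (b%:R ^+ i * x) - b%:Z ^+ i * Num.floor x)%R.
  have E : frac_part x * b%:R ^+ i = frac_part (b%:R ^+ i * x) + m%:~R.
    by rewrite /m /frac_part intrB intrM rmorphXn/=; ring.
  have m0 : (0 <= m)%R.
    have [_ z1] := andP (frac_part_itv (b%:R ^+ i * x)).
    have : 0 <= frac_part x * b%:R ^+ i by rewrite mulr_ge0// exprn_ge0.
    rewrite E => h; have : -1 < m%:~R :> R by lra.
    rewrite -[-1]/((-1)%:~R) ltr_int; lia.
  by exists `|m|%N; rewrite E; congr (_ + _); rewrite natr_absz ger0_norm.
rewrite /digit -addnS exprD mulrA HK mulrDl.
rewrite -[X in K%:R * X]natrX -(natrM _ K).
have [z0 _] := andP (frac_part_itv (b%:R ^+ i * x)).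
rewrite [X in Num.truncn X]addrC truncnD ?nnegrE ?natr_nat ?mulr_ge0 ?exprn_ge0//.
by rewrite natrK expnSr mulnA modnMDl.
Qed.
End words.

(** * The criterion of Weyl for normality *)

Lemma occurs_at_itv (R : realType) (b : nat) (x : R) (w : seq 'I_b) (i : nat) :
  (2 <= b)%N ->
  value R b (map val w) <= frac_part (b%:R ^+ i * x) <
    value R b (map val w) + b%:R ^- size w -> occurs_at x w i.
Proof.
move=> b2 h; have wb : all (gtn b) (map val w).
  by apply/allP => d /mapP[a _ ->]; exact: ltn_ord.
rewrite -(size_map val) in h; apply/eqP.
rewrite -(prefix_digits_itv b2 wb h) size_map.
by apply: eq_map => j; exact: digit_shift.
Qed.

(** The lower bounds of [weyl_lower] for all words of the same length give the
    upper bound for one of them, because at each position at most one word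
    occurs. *)
Lemma normal_of_mean0 (R : realType) (b : nat) (x : R) : (2 <= b)%N ->
  (forall (h : nat) (beta : R), (0 < h)%N ->
     mean0 (fun n => wave (h%:R * b%:R ^+ n * x + beta))) ->
  normal b x.
Proof.
move=> b2 hx w; set l := size w.
have b0 : (0 < b)%N by exact: leq_trans b2.
have L0 : (0 < b ^ l)%N by rewrite expn_gt0 b0.
have hz (h : nat) (beta : R) : (0 < h)%N ->
    mean0 (fun n => wave (h%:R * (b%:R ^+ n * x) + beta)).
  by move=> h0; apply: mean0_ext (hx h beta h0) => n; rewrite mulrA.
pose q : R := (b ^ l)%:R^-1.
have qE : b%:R ^- l = q by rewrite /q natrX.
have lower (v : l.-tuple 'I_b) (e : R) : 0 < e -> exists N0, forall N, (N0 <= N)%N ->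
    (q - e) * N%:R <= (occurrences x v N)%:R.
  move=> e0; have vb : all (gtn b) (map val v).
    by apply/allP => d /mapP[a _ ->]; exact: ltn_ord.
  have [A] := value_nat R b2 vb; rewrite size_map size_tuple => AL vE.
  have [N0 hN0] := weyl_lower hz AL e0; exists N0 => N /hN0 /le_trans; apply.
  rewrite /occurrences -sum1_count natr_sum [leRHS]big_mkcond /= /index_iota subn0.
  apply: ler_sum => n _; case: ifPn => [_|]; first by case: (_ && _).
  move/negP => no; rewrite (_ : (_ && _) = false)//; apply/negP => h; apply: no.
  apply: occurs_at_itv => //; rewrite size_tuple vE.
  by move: h; rewrite natrX -[A.+1%:R]natr1 mulrDl mul1r.
have one (n : nat) : \sum_(v : l.-tuple 'I_b) (occurs_at x v n)%:R <= 1 :> R.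
  case: (pickP (fun v : l.-tuple 'I_b => occurs_at x v n)) => [v hv|no]; last first.
    by rewrite big1// => v _; rewrite no.
  rewrite (bigD1 v)//= hv big1 ?addr0// => v' v'v.
  rewrite (_ : occurs_at x v' n = false)//; apply/negP => hv'; move/negP: v'v; apply.
  apply/eqP/val_inj; apply: (inj_map val_inj).
  by move: hv hv'; rewrite /occurs_at !size_tuple => /eqP <- /eqP <-.
have upper N : \sum_(v : l.-tuple 'I_b) (occurrences x v N)%:R <= N%:R :> R.
  rewrite (eq_bigr (fun v : l.-tuple 'I_b =>
      \sum_(0 <= n < N) (occurs_at x v n)%:R)); last first.
    move=> v _; rewrite /occurrences -sum1_count natr_sum big_mkcond /= /index_iota subn0.
    by apply: eq_bigr => n _; case: occurs_at.
  rewrite exchange_big/=; apply: (@le_trans _ _ (\sum_(0 <= n < N) 1)).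
    by apply: ler_sum.
  by rewrite sumr_const_nat subn0.
pose wt : l.-tuple 'I_b := in_tuple w.
have card : #|{: l.-tuple 'I_b}| = (b ^ l)%N by rewrite card_tuple card_ord.
rewrite qE; apply/cvgrPdist_le => e e0.
(* The errors of the b ^ l - 1 other words add up in the upper bound. *)
pose e' := e / (b ^ l)%:R.
have LR : 0 < (b ^ l)%:R :> R by rewrite ltr0n.
have e'0 : 0 < e' by rewrite divr_gt0.
have /choice[f hf] := fun v => lower v e' e'0.
near=> N.
have Nf v : (f v <= N)%N.
  apply: (@leq_trans (\max_v f v)); first exact: leq_bigmax.
  by near: N; exact: nbhs_infty_ge.
have N0 : 0 < N%:R :> R by rewrite ltr0n; near: N; exact: nbhs_infty_gt.
have lo := hf wt N (Nf wt).
have up := upper N; rewrite (bigD1 wt)//= in up.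
have others : ((b ^ l)%:R - 1) * ((q - e') * N%:R) <=
    \sum_(v | v != wt) (occurrences x v N)%:R.
  apply: (@le_trans _ _ (\sum_(v : l.-tuple 'I_b | v != wt) ((q - e') * N%:R))).
    rewrite sumr_const -[leRHS]mulr_natl le_eqVlt; apply/orP; left; apply/eqP.
    by congr (_ * _); rewrite (cardC1 wt) card -subn1 natrB.
  by apply: ler_sum => v _; exact: hf.
have ee : e' <= e by rewrite ler_pdivrMr// ler_peMr ?ler1n// ltW.
have e'L : (b ^ l)%:R * e' = e by rewrite mulrC divfK// gt_eqF.
have qL : (b ^ l)%:R * q = 1 by rewrite mulfV// gt_eqF.
rewrite -/l; change (occurrences x w N) with (occurrences x wt N).
move: lo up others; set O := (occurrences x wt N)%:R; set S := \sum_(_ | _) _ => lo up oth.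
have -> : q - O / N%:R = (q * N%:R - O) / N%:R by rewrite mulrBl mulfK// gt_eqF.
rewrite normrM normfV (gtr0_norm N0) ler_pdivrMr// ler_norml.
have ineq : ((b ^ l)%:R - 1) * ((q - e') * N%:R) =
  ((b ^ l)%:R * q - q - (b ^ l)%:R * e' + e') * N%:R by ring.
rewrite ineq qL e'L in oth.
have eN : e' * N%:R <= e * N%:R by rewrite ler_wpM2r// ltW.
have e'N : 0 < e' * N%:R by rewrite mulr_gt0.
by apply/andP; split; lra.
Unshelve. all: by end_near. Qed.

(** * From finite averages to almost every real number *)

Lemma frac_part_int (R : realType) (u : R) (m : int) :
  m%:~R <= u < m%:~R + 1 -> frac_part u = u - m%:~R.
Proof.
move=> h; rewrite /frac_part (_ : Num.floor u = m)//.
by apply: floor_def; rewrite intrD.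
Qed.

Section cover.
Variables (R : realType) (M : nat) (m : int).
Hypothesis M2 : (2 <= M)%N.
Local Notation mu := (@lebesgue_measure R).
Let MR : 0 < M%:R :> R. Proof. by rewrite ltr0n (leq_trans _ M2). Qed.

Let unit_itv := [set u : R | m%:~R <= u < m%:~R + 1].

(** Words with prefix w0 correspond to an interval of length M ^ - size w0.
    Splitting according to the next digit follows the recursion that defines
    [avg]. *)
Lemma cylinder_cover (P : pred (seq nat)) p w0 :
  exists A : set R, [/\ measurable A,
    (mu A <= (avg M p (fun w => (P (w0 ++ w))%:R) / M%:R ^+ size w0)%:E)%E &
    [set u | unit_itv u /\ exists w, [/\ size w = p, all (gtn M) w, P (w0 ++ w) &
      prefix_digits M u (size w0 + p) = w0 ++ w]] `<=` A].
Proof.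
elim: p w0 => [|p IH] w0.
  case: (boolP (P w0)) => Pw0; last first.
    exists set0; split => //; first by rewrite measure0 lee_fin divr_ge0 ?exprn_ge0.
    move=> u [_ [w [/size0nil -> _]]]; rewrite cats0 => Pw; exfalso.
    by move: Pw0; rewrite Pw.
  exists `[m%:~R + value R M w0, m%:~R + value R M w0 + M%:R ^- size w0[%classic.
  split=> //.
    rewrite lebesgue_measure_itv/= lte_fin ltrDl invr_gt0 exprn_gt0//.
    by rewrite -EFinD addrAC subrr add0r cats0 Pw0 mul1r.
  move=> u [Iu [w [/size0nil -> _ _]]]; rewrite cats0 addn0 => uw /=.
  have := value_prefix_digits M2 u (size w0); rewrite uw (frac_part_int Iu).
  by rewrite in_itv/=; case/andP => h1 h2; apply/andP; split; lra.
have /choice[f hf] := fun d => IH (rcons w0 d).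
exists (\big[setU/set0]_(d < M) f d); split.
- by apply: bigsetU_measurable => d _; have [] := hf d.
- have mf i : (i < M)%N -> measurable (f i) by move=> _; have [] := hf i.
  apply: le_trans (Boole_inequality mu mf) _.
  apply: (@le_trans _ _ (\sum_(d < M) (avg M p (fun w => (P (rcons w0 d ++ w))%:R) /
     M%:R ^+ size (rcons w0 d))%:E)%E).
    by apply: lee_sum => d _; have [] := hf d.
  rewrite sumEFin lee_fin/= big_mkord 2!mulr_suml; apply: ler_sum => d _.
  rewrite size_rcons exprS invfM mulrA le_eqVlt; apply/orP; left; apply/eqP.
  by congr (_ / _ / _); apply: eq_avg => w _; rewrite cat_rcons.
- move=> u [Iu [w [sw wM Pw uw]]].
  case: w sw wM Pw uw => [//|d w] /= [sw] /andP[dM wM] Pw uw.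
  rewrite -bigcup_mkord; exists d => //=.
  have [_ _] := hf d; apply; split => //; exists w; split => //.
    by rewrite cat_rcons.
  by rewrite size_rcons addSnnS uw cat_rcons.
Qed.

Lemma digits_cover (P : pred (seq nat)) p :
  exists A : set R, [/\ measurable A,
    (mu A <= (avg M p (fun w => (P w)%:R))%:E)%E &
    [set u | unit_itv u /\ P (prefix_digits M u p)] `<=` A].
Proof.
have [A [mA muA sub]] := cylinder_cover P p [::].
exists A; split => //; first by move: muA; rewrite expr0 divr1.
move=> u [Iu Pu]; apply: sub; split => //; exists (prefix_digits M u p).
by split; rewrite ?size_prefix_digits ?prefix_digits_lt.
Qed.

Variables (F : nat -> seq nat -> R) (l p : nat -> nat) (c : nat).
Hypotheses (F1 : forall n w, `|F n w| <= 1).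
Hypotheses (lp : forall n, (l n <= p n)%N).
Hypothesis gap : forall m n, (m + c <= n)%N -> (p m <= l n)%N.
Hypothesis pm : forall m n, (m <= n)%N -> (p m <= p n)%N.

Let M0 : (0 < M)%N. Proof. exact: leq_trans M2. Qed.

Let fl n (u : R) := fluct M F l p n (prefix_digits M u (p n)).

Let take_prefix (u : R) q q' : (q <= q')%N ->
  take q (prefix_digits M u q') = prefix_digits M u q.
Proof. by move=> qq; rewrite /prefix_digits -map_take take_iota (minn_idPl qq). Qed.

Let flE n u q : (p n <= q)%N -> fluct M F l p n (prefix_digits M u q) = fl n u.
Proof.
move=> nq; rewrite /fl /fluct /cond_avg !take_prefix// ?(leq_trans (lp n))//.
Qed.

(** Deviations of size eta N have probability O(1 / N), which is summable along
    the squares, so by the lemma of Borel and Cantelli almost every u has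
    finitely many of them. Between two squares the sum of the bounded
    fluctuations changes by a negligible amount. *)
Lemma fluct_ae (eta : R) : 0 < eta ->
  mu.-negligible [set u | unit_itv u /\
    ~ exists N0, forall N, (N0 <= N)%N -> `|\sum_(0 <= n < N) fl n u| <= 2 * eta * N%:R].
Proof.
move=> eta0.
(* The inverses of the squares are summable, and the quotients of consecutive
   squares tend to 1. *)
pose N k := (k.+1 ^ 2)%N.
pose P k : pred (seq nat) := fun w => eta * (N k)%:R <= `|\sum_(0 <= n < N k) fluct M F l p n w|.
have /choice[A hA] := fun k => digits_cover (P k) (p (N k)).
have muA k : (mu (A k) <= ((8 * c)%:R / eta ^+ 2 * (2 / k.+1%:R - 2 / k.+2%:R))%:E)%E.
  have [_ /le_trans + _] := hA k; apply; rewrite lee_fin.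
  apply: le_trans (@fluct_deviation _ _ _ _ _ c M0 F1 lp gap (p (N k)) _ _ eta0 _ _) _ => //.
    by move=> n nN; rewrite pm// ltnW.
  rewrite invfM mulrA ler_wpM2l ?divr_ge0 ?exprn_ge0 ?(ltW eta0)//.
  have -> : 2 / k.+1%:R - 2 / k.+2%:R = 2 / (k.+1%:R * k.+2%:R) :> R.
    move: (ltr0Sn R k); rewrite -[k.+2%:R]natr1; move: (k.+1%:R : R) => r r0.
    by field; rewrite !gt_eqF// addr_gt0.
  rewrite ler_pdivlMr ?mulr_gt0// mulrC ler_pdivrMr ?ltr0n// -!natrM ler_nat /N; lia.
have sumA : (\sum_(k <oo) mu (A k) < +oo)%E.
  apply: (@le_lt_trans _ _ ((8 * c)%:R / eta ^+ 2 * 2)%:E); last exact: ltry.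
  apply: lime_le; first by apply: is_cvg_nneseries => *.
  apply: nearW => n.
  apply: (@le_trans _ _ ((8 * c)%:R / eta ^+ 2 * (2 - 2 / n.+1%:R))%:E).
    elim: n => [|n IH]; first by rewrite big_nil divr1 subrr mulr0.
    rewrite big_nat_recr//=; apply: le_trans (leeD IH (muA n)) _.
    by rewrite -EFinD lee_fin -mulrDr addrA subrK.
  rewrite lee_fin ler_wpM2l ?divr_ge0 ?exprn_ge0 ?(ltW eta0)//.
  by rewrite gerBl divr_ge0.
have mA k : measurable (A k) by have [] := hA k.
exists (lim_sup_set A); split.
- by apply: bigcapT_measurable => k; apply: bigcup_measurable => j _; exact: mA.
- exact: lim_sup_set_cvg0.
move=> u [Iu nu]; apply: contrapT => nl; apply: nu.
have [k0 hk0] : exists k0, forall k, (k0 <= k)%N -> `|\sum_(0 <= n < N k) fl n u| <= eta * (N k)%:R.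
  apply: contrapT => H; apply: nl => k _.
  apply: contrapT => H2; apply: H; exists k => j kj.
  apply: contrapT => H3; apply: H2; exists j => //.
  have [_ _] := hA j; apply; split => //.
  rewrite /P ltW// ltNge; apply/negP => H4; apply: H3; apply: le_trans H4.
  rewrite le_eqVlt; apply/orP; left; apply/eqP; congr (`|_|).
  by apply: eq_big_nat => n /andP[_ nN]; rewrite flE// pm// ltnW.
(* From k1 on, the 2 k + 3 terms between two consecutive squares, each at most
   2, amount to at most eta times the smaller square. *)
pose k1 := maxn k0 (Num.truncn (10 / eta)).
exists (k1.+1 ^ 2)%N => n hn.
have [k [hk1 kn nk]] : exists k, [/\ (k1 <= k)%N, (N k <= n)%N & (n < N k.+1)%N].
  have ex : exists k, (N k <= n)%N by exists k1.
  have bd k : (N k <= n)%N -> (k <= n)%N by rewrite /N; lia.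
  case: (ex_maxnP ex bd) => k hk kmax.
  exists k; split => //; first exact: kmax.
  by rewrite ltnNge; apply/negP => /kmax; rewrite ltnn.
have k0k : (k0 <= k)%N by apply: leq_trans hk1; exact: leq_maxl.
have hk := hk0 k k0k.
have etak : 10 <= eta * k.+1%:R.
  rewrite mulrC -ler_pdivrMr//; apply: le_trans (ltW (truncnS_gt _)) _.
  by rewrite ler_nat ltnS (leq_trans _ hk1)// leq_maxr.
rewrite (@big_cat_nat _ _ _ (N k))//=.
apply: le_trans (ler_normD _ _) _.
have rest : `|\sum_(N k <= i < n) fl i u| <= 2 * (2 * k.+1%:R + 1).
  apply: le_trans (ler_norm_sum _ _ _) _.
  apply: (@le_trans _ _ (\sum_(N k <= i < n) 2)).
    by apply: ler_sum => i _; exact: norm_fluct.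
  rewrite sumr_const_nat -[leLHS]mulr_natr ler_wpM2l//.
  by rewrite -natrM natr1 ler_nat; move: nk; rewrite /N; clear; lia.
have kN : eta * (N k)%:R <= eta * n%:R by rewrite ler_wpM2l ?(ltW eta0)// ler_nat.
have : 10 * k.+1%:R <= eta * (N k)%:R.
  by rewrite /N natrX expr2 mulrA ler_wpM2r.
have : 1 <= k.+1%:R :> R by rewrite ler1n.
lra.
Qed.
End cover.

(** * Almost sure absolute normality *)

Section ae.
Variables (R : realType) (M B : nat) (m : int) (y : R -> R).
Hypotheses (M2 : (2 <= M)%N) (B2 : (2 <= B)%N).
Hypothesis yP : forall u p, `|y u - value R B (prefix_digits M u p)| <= B%:R ^- p.

Let unit_itv := [set u : R | m%:~R <= u < m%:~R + 1].
Let BR : 0 < B%:R :> R. Proof. by rewrite ltr0n (leq_trans _ B2). Qed.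
Let M0 : (0 < M)%N. Proof. exact: leq_trans M2. Qed.
Local Notation mu := (@lebesgue_measure R).

Section one_frequency.
Variables (a : nat) (th : R) (beta : nat -> R).
Hypotheses (a2 : (2 <= a)%N) (irr : irrational th).

Let exponent_ge n k : (B ^ k <= n)%N -> (k <= exponent a B n)%N.
Proof.
move=> kn; apply: trunc_log_max => //; apply: leq_trans kn _.
by apply: ltnW; exact: ltn_expl.
Qed.

Let gap K k n : (k + B ^ K <= n)%N -> (exponent a B k + K <= exponent a B n)%N.
Proof.
move=> kn; apply: trunc_log_max => //; rewrite expnD.
apply: (@leq_trans (a ^ (k + B ^ K))); last by rewrite leq_pexp2l// (leq_trans _ a2).
have /andP[h _] := exponent_bounds a2 B2 k.
by rewrite expnD leq_mul// ltnW// ltn_expl.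
Qed.

Let freq n : R := th * a%:R ^+ n.

Let F n w := wave (freq n * value R B w + beta n).

(** Given the first digits, the remaining ones enter through a wave of frequency
    th a^n / B^(exponent n - K), whose attenuation factors at the first K digits
    are those of damp in reverse order. *)
Lemma cond_avg_damp K K' n w : (K <= exponent a B n)%N -> (exponent a B n - K <= size w)%N ->
  `|cond_avg M F (fun n => exponent a B n - K)%N (fun n => exponent a B n + K')%N n w| <=
  damp M B K (th * mantissa R a B n).
Proof.
move=> Kn nw; rewrite /cond_avg.
set q := (_ + _ - _)%N; set w0 := take _ w.
have qE : q = (K + K')%N by rewrite /q; move: Kn; clear; lia.
have sw0 : size w0 = (exponent a B n - K)%N by rewrite size_takel.
set eta := freq n / B%:R ^+ (exponent a B n - K).
rewrite (@eq_avg _ _ _ _ (fun v => wave (eta * value R B v +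
    (freq n * value R B w0 + beta n)))); last first.
  by move=> v _; rewrite /F value_cat sw0; congr wave; rewrite /eta; ring.
apply: le_trans (norm_avg_wave_le _ _ _ _ M2) _.
rewrite qE big_split_ord/=.
have att (t : R) : 0 <= attenuation M t <= 1.
  by rewrite attenuation_ge0 ?attenuation_le1.
have att0 (I : finType) (g : I -> R) : 0 <= \prod_(i : I) attenuation M (g i).
  by apply: prodr_ge0 => i _; have /andP[] := att (g i).
rewrite -[leRHS]mulr1 ler_pM//.
  rewrite le_eqVlt; apply/orP; left; apply/eqP.
  rewrite /damp (reindex_inj rev_ord_inj)/=; apply: eq_bigr => i _.
  congr (attenuation M _); rewrite /eta /freq /mantissa.
  have iK := ltn_ord i.
  have -> : (K - i.+1).+1 = (K - i)%N by move: iK; clear; lia.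
  have -> : B%:R ^+ exponent a B n =
      B%:R ^+ (exponent a B n - K) * (B%:R ^+ (K - i) * B%:R ^+ i) :> R.
    by rewrite -!exprD; congr (_ ^+ _); move: iK Kn; clear; lia.
  by field; rewrite ?gt_eqF ?exprn_gt0.
apply: (le_trans (@ler_prod _ _ _ _ _ (fun=> 1) _)); first by move=> i _; exact: att.
by rewrite prodr_const expr1n.
Qed.

(** Each wave is the sum of its fluctuation, of its conditional expectation and
    of an error due to the truncation of y; the three have small means by
    [fluct_ae], by [damp_mean_small] and by the choice of K' respectively. *)
Lemma mean_wave_ae (e : R) : 0 < e -> mu.-negligible [set u | unit_itv u /\
  ~ exists N0, forall N, (N0 <= N)%N ->
    `|\sum_(0 <= n < N) wave (freq n * y u + beta n)| <= e * N%:R].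
Proof.
move=> e0; have e8 : 0 < e / 8 by rewrite divr_gt0.
have [K [N1 hN1]] := damp_mean_small a2 B2 irr M2 e8.
(* Digits of y beyond exponent n + K' move the argument of the n-th wave by at
   most |th| * B * B ^ - K'. *)
have [K' hK'] : exists K', 2 * pi * `|th| * B%:R * B%:R ^- K' <= e / 8.
  set C := 2 * pi * `|th| * B%:R.
  exists (Num.truncn (C / (e / 8))).+1.
  rewrite ler_pdivrMr ?exprn_gt0// mulrC -ler_pdivrMr//.
  apply: le_trans (ltW (truncnS_gt _)) _; rewrite -natrX ler_nat.
  by apply: ltnW; exact: ltn_expl.
pose l n := (exponent a B n - K)%N; pose p n := (exponent a B n + K')%N.
pose c := (B ^ (K + K'))%N.
have F1 n w : `|F n w| <= 1 by exact: norm_wave.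
have lp n : (l n <= p n)%N by rewrite /l /p; clear; lia.
have gapc k n : (k + c <= n)%N -> (p k <= l n)%N.
  by move=> /gap; rewrite /p /l; clear; lia.
have pm k n : (k <= n)%N -> (p k <= p n)%N.
  by move=> kn; rewrite leq_add2r exponent_le.
apply: negligibleS (fluct_ae m M2 F1 lp gapc pm e8) => u [Iu nu].
split => // -[N2 hN2]; apply: nu.
(* Only for n < n0 can exponent n be less than K; these terms are at most 1. *)
pose n0 := (B ^ K)%N.
exists (maxn (maxn N1 N2) (Num.truncn (n0%:R / (e / 8))).+1) => N.
rewrite !geq_max => /andP[/andP[/hN1 H1 /hN2 H2] H3].
have n0e : n0%:R <= e / 8 * N%:R.
  rewrite mulrC -ler_pdivrMr//; apply: le_trans (ltW (truncnS_gt _)) _.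
  by rewrite ler_nat.
pose w n := prefix_digits M u (p n).
have split n : wave (freq n * y u + beta n) =
   fluct M F l p n (w n) + cond_avg M F l p n (w n) +
   (wave (freq n * y u + beta n) - F n (w n)).
  by rewrite /fluct take_oversize ?size_prefix_digits//; ring.
rewrite (eq_bigr _ (fun n _ => split n)) 2!big_split/=.
have B1 : `|\sum_(0 <= n < N) cond_avg M F l p n (w n)| <= n0%:R + e / 8 * N%:R.
  apply: le_trans (ler_norm_sum _ _ _) _.
  apply: (@le_trans _ _ (\sum_(0 <= n < N) ((n < n0)%N%:R + damp M B K (th * mantissa R a B n)))).
    apply: ler_sum => n _; case: (ltnP n n0) => nn0.
      by apply: ler_wpDr; [exact: damp_ge0|apply: ler_norm_avg].
    rewrite add0r; apply: cond_avg_damp; first exact: exponent_ge.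
    by rewrite size_prefix_digits lp.
  rewrite big_split/= lerD//.
  have -> : \sum_(0 <= n < N) (n < n0)%N%:R = (count (ltn^~ n0) (iota 0 N))%:R :> R.
    rewrite -sum1_count natr_sum [RHS]big_mkcond /index_iota subn0.
    by apply: eq_bigr => i _ /=; case: ltnP.
  rewrite ler_nat -size_filter -[leqRHS](size_iota 0).
  apply: uniq_leq_size; first by rewrite filter_uniq// iota_uniq.
  by move=> i; rewrite mem_filter !mem_iota => /andP[].
have B2' : `|\sum_(0 <= n < N) (wave (freq n * y u + beta n) - F n (w n))| <= e / 8 * N%:R.
  apply: le_trans (ler_norm_sum _ _ _) _.
  apply: (@le_trans _ _ (\sum_(0 <= n < N) (e / 8))); last first.
    by rewrite sumr_const_nat subn0 -[leLHS]mulr_natr.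
  apply: ler_sum => n _; apply: le_trans hK'.
  apply: le_trans (wave_lip _ _) _.
  rewrite opprD addrACA subrr addr0 -mulrBr normrM /freq normrM.
  rewrite -!mulrA ler_wpM2l// ler_wpM2l ?pi_ge0// ler_wpM2l//.
  rewrite ger0_norm ?exprn_ge0//.
  apply: (@le_trans _ _ (a%:R ^+ n * B%:R ^- p n)).
    by rewrite ler_wpM2l ?exprn_ge0// yP.
  rewrite /p exprD invfM mulrA ler_wpM2r ?invr_ge0 ?exprn_ge0//.
  by apply: ltW; exact: mantissa_lt.
have H2' : `|\sum_(0 <= n < N) fluct M F l p n (w n)| <= 2 * (e / 8) * N%:R by exact: H2.
apply: le_trans (ler_normD _ _) _; apply: le_trans (lerD (ler_normD _ _) (lexx _)) _.
have : 0 <= e * N%:R by rewrite mulr_ge0// ltW.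
lra.
Qed.
End one_frequency.

Lemma irrational_mulrn (th : R) h : irrational th -> irrational (h.+1%:R * th).
Proof.
move=> irr /rationalP[p [q E]]; apply: irr; apply/rationalP.
exists p, (q * h.+1)%N; rewrite natrM invfM mulrA -E mulrAC divff ?mul1r//.

Qed.

(** Phases 0 and 1/4 suffice for the criterion of Weyl, since they give the
    cosine and the sine, so that countably many null sets have to be avoided. *)
Lemma absolutely_normal_ae (th c : R) : irrational th ->
  mu.-negligible [set u | unit_itv u /\ ~ absolutely_normal (c + th * y u)].
Proof.
move=> irr.
pose W a h s (u : R) n : R := wave (h.+1%:R * a.+2%:R ^+ n * (c + th * y u) + s%:R / 4).
pose E a h s k := [set u : R | unit_itv u /\ ~ exists N0, forall N, (N0 <= N)%N ->
    `|\sum_(0 <= n < N) W a h s u n| <= k.+1%:R^-1 * N%:R].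
have negE a h s k : mu.-negligible (E a h s k).
  have k0 : 0 < k.+1%:R^-1 :> R by [].
  have := @mean_wave_ae a.+2 (h.+1%:R * th)
    (fun n => h.+1%:R * a.+2%:R ^+ n * c + s%:R / 4) isT (irrational_mulrn (h := h) irr) _ k0.
  congr (_.-negligible _).
  rewrite /E; apply/funext => u; congr (_ /\ ~ _).
  apply: eq_exists => N0; apply: eq_forall => N; congr (_ -> `|_| <= _).
  by apply: eq_bigr => n _; rewrite /W; congr wave; ring.
have neg : mu.-negligible (\bigcup_a \bigcup_h \bigcup_s \bigcup_k E a h s k).
  by apply: negligible_bigcup => a; apply: negligible_bigcup => h;
    apply: negligible_bigcup => s; exact: negligible_bigcup.
apply: negligibleS neg => u [Iu nn].
apply: contrapT => nE; apply: nn => -[|[|a]]//= _.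
have mW h s : mean0 (W a h s u).
  move=> e e0; have ek : (Num.truncn e^-1).+1%:R^-1 < e.
    by rewrite invf_plt ?posrE//; exact: truncnS_gt.
  have [N0 hN0] : exists N0, forall N, (N0 <= N)%N ->
      `|\sum_(0 <= n < N) W a h s u n| <= (Num.truncn e^-1).+1%:R^-1 * N%:R.
    apply: contrapT => nex; apply: nE; exists a => //; exists h => //; exists s => //.
    by exists (Num.truncn e^-1).
  by exists N0 => N /hN0 /le_trans; apply; rewrite ler_wpM2r// ltW.
apply: normal_of_mean0 => // -[//|h] b _.
apply: mean0_ext (mean0D (mean0Z (cos (2 * pi * b)) (mW h 0%N)) (mean0Z (sin (2 * pi * b)) (mW h 1%N))) => n.
rewrite /W mul0r addr0 /wave; set X := _ * (c + _).
have -> : 2 * pi * (X + 1 / 4) = 2 * pi * X + pi / 2 by field.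
have -> : 2 * pi * (X + b) = 2 * pi * X + 2 * pi * b by ring.
by rewrite cosDpihalf (cosD (2 * pi * X)); ring.
Qed.
End ae.

(** * Hausdorff measure *)

Section hausdorff.
Variable R : realType.
Local Open Scope ereal_scope.
Implicit Types (U E : set R) (s : R).
Local Notation mu := (@lebesgue_measure R).

Lemma diameter_ge0 U : 0 <= diameter U.
Proof. by apply: ereal_sup_ubound; left. Qed.

Lemma diameter_pow_ge0 s U : 0 <= diameter_pow s U.
Proof. by rewrite /diameter_pow; case: ifP => // _; exact: poweR_ge0. Qed.

Lemma le_diameter U (x y : R) : U x -> U y -> `|x - y|%:E <= diameter U.
Proof. by move=> Ux Uy; apply: ereal_sup_ubound; right; exists (x, y). Qed.

Lemma hausdorff_content_ge0 s d E : 0 <= hausdorff_content s d E.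
Proof.
apply: le_ereal_inf_tmp => _ [U _ <-]; apply: nneseries_ge0 => k _ _.
exact: diameter_pow_ge0.
Qed.

Lemma diameter_itv (a b : R) : diameter `]a, b[%classic <= wlength idfun `]a, b[%classic.
Proof.
rewrite wlength_itv/=; case: ifPn => [|nab].
  rewrite lte_fin => ab; apply: ge_ereal_sup => _ [->|[[x y] [/= xI yI] <-]].
    by rewrite -EFinD lee_fin subr_ge0 ltW.
  rewrite -EFinD lee_fin; move: xI yI; rewrite !in_itv/= => /andP[x1 x2] /andP[y1 y2].
  by rewrite ler_norml; apply/andP; split; lra.
apply: ge_ereal_sup => _ [->//|[[x y] [/= xI _] <-]]; exfalso.
move: xI nab; rewrite in_itv/= lte_fin => /andP[x1 x2].
by rewrite (lt_trans x1 x2).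
Qed.

(** Covers of a null set by intervals of small total length also have small
    individual lengths, and the diameter of an interval is at most its length. *)
Lemma hausdorff_measure1_negligible E :
  mu.-negligible E -> hausdorff_measure 1 E = 0.
Proof.
move=> /negligible_outer_measure; rewrite outer_measure_open_itv_cover => E0.
have c0 (d : R) : (0 < d)%R -> hausdorff_content 1 d E = 0.
  move=> d0; apply/eqP; rewrite eq_le hausdorff_content_ge0 andbT.
  apply/lee_addgt0Pr => e e0; rewrite add0e.
  have m0 : (0 < Num.min d e)%R by rewrite lt_min d0.
  have [_ [F [Fo EF] <-] Fm] : exists2 x, [set \sum_(k <oo) wlength idfun (F k) |
      F in open_itv_cover E] x & x < (Num.min d e)%:E.
    by apply: ereal_inf_lt; rewrite E0 lte_fin.
  have l0 k : 0 <= wlength idfun (F k) by exact: wlength_ge0.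
  have dF k : diameter (F k) <= wlength idfun (F k).
    by have [[a b] ->] := Fo k; exact: diameter_itv.
  have FM k : wlength idfun (F k) <= (Num.min d e)%:E.
    apply: le_trans (ltW Fm); apply: le_trans (nneseries_lim_ge k.+1 _) => //.
    by rewrite big_nat_recr//= leeDr// sume_ge0.
  apply: (@le_trans _ _ (\sum_(k <oo) diameter_pow 1 (F k))).
    apply: ereal_inf_lbound; exists F => //; split => // k.
    apply: le_trans (dF k) (le_trans (FM k) _).
    by rewrite lee_fin ge_min lexx.
  apply: (@le_trans _ _ (\sum_(k <oo) wlength idfun (F k))).
    apply: lee_nneseries => [k _ _|k _]; first exact: diameter_pow_ge0.
    rewrite /diameter_pow; case: ifP => // _.
    by rewrite poweRe1 ?diameter_ge0.
  apply: le_trans (ltW Fm) _.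
  by rewrite lee_fin ge_min lexx orbT.
apply/eqP; rewrite eq_le; apply/andP; split.
  by apply: ge_ereal_sup => _ [d d0 <-]; rewrite c0.
apply: ereal_sup_ubound; exists 1%R; [exact: ltr01|exact: c0].
Qed.

(** A cover of E by sets U k pulls back under f to a cover of almost all of
    [0, 1) by sets of diameter at most C times the power s of the diameter of
    U k, hence the sum of these powers is bounded below. *)
Lemma hausdorff_measure_holder s (C : R) (f : R -> R) (G E : set R) :
  (0 <= s)%R -> (0 < C)%R ->
  (forall u v : R, (0 <= u < 1)%R -> (0 <= v < 1)%R ->
     (`|u - v| <= C * `|f u - f v| `^ s)%R) ->
  mu.-negligible [set u : R | (0 <= u < 1)%R /\ ~ G u] ->
  (forall u : R, (0 <= u < 1)%R -> G u -> E (f u)) ->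
  hausdorff_measure s E != 0.
Proof.
move=> s0 C0 hf [N [mN N0 sN]] GE; apply/negP => /eqP H0.
have content0 : hausdorff_content s 1 E <= 0.
  by rewrite -H0; apply: ereal_sup_ubound; exists 1%R => //; exact: ltr01.
have c0 : (0 < (4 * C)^-1)%R by rewrite invr_gt0 mulr_gt0.
have [_ [U [EU dU] <-] Uc] : exists2 x, [set \sum_(k <oo) diameter_pow s (U k) | U in
    [set U : (set R)^nat | E `<=` \bigcup_k U k /\ forall k, diameter (U k) <= 1%:E]] x
    & x < (4 * C)^-1%:E.
  by apply: ereal_inf_lt; apply: le_lt_trans content0 _; rewrite lte_fin.
have cov k : exists A : set R, [/\ measurable A, mu A <= (2 * C)%:E * diameter_pow s (U k) &
    forall u : R, (0 <= u < 1)%R -> G u -> U k (f u) -> A u].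
  have [[u0 [u01 Gu0 Uu0]]|no] := pselect (exists u : R, [/\ (0 <= u < 1)%R, G u & U k (f u)]); last first.
    exists set0; split => //.
      by rewrite measure0 mule_ge0 ?lee_fin ?mulr_ge0 ?(ltW C0) ?diameter_pow_ge0.
    by move=> u u01 Gu Uu; apply: no; exists u.
  have [d dE] : exists d : R, diameter (U k) = d%:E.
    exists (fine (diameter (U k))); rewrite fineK// ge0_fin_numE ?diameter_ge0//.
    by apply: le_lt_trans (dU k) _; rewrite ltry.
  have dpow : diameter_pow s (U k) = (d `^ s)%:E.
    rewrite /diameter_pow ifF ?dE//; apply/negbTE/set0P; exact: (ex_intro _ _ Uu0).
  pose r := (C * d `^ s)%R.
  have r0 : (0 <= r)%R by rewrite mulr_ge0 ?powR_ge0 ?(ltW C0).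
  exists `[(u0 - r)%R, (u0 + r)%R]%classic; split => //.
    rewrite lebesgue_measure_itv/= dpow; case: ifP => _.
      by rewrite -EFinD -EFinM lee_fin /r; lra.
    by rewrite mule_ge0 ?lee_fin ?mulr_ge0 ?(ltW C0) ?powR_ge0.
  move=> u u01' Gu Uu /=; rewrite in_itv/= -ler_distl.
  apply: le_trans (hf _ _ u01' u01) _.
  have fd : (`|f u - f u0| <= d)%R by rewrite -lee_fin -dE le_diameter.
  rewrite ler_wpM2l ?(ltW C0)// ge0_ler_powR ?nnegrE//.
  exact: le_trans (normr_ge0 _) fd.
have /choice[A hA] := cov.
have mA k : measurable (A k) by have [] := hA k.
have sub : `[0%R, 1%R[%classic `<=` N `|` \bigcup_k A k.
  move=> u /=; rewrite in_itv/= => u01.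
  have [Gu|nGu] := pselect (G u); last by left; apply: sN.
  right; have [k _ Uk] := EU _ (GE u u01 Gu); exists k => //.
  by have [_ _] := hA k; apply.
have mU : measurable (\bigcup_k A k) by exact: bigcup_measurable.
have : mu `[0%R, 1%R[%classic <= mu N + mu (\bigcup_k A k).
  apply: le_trans (measureU2 _ mN mU).
  by rewrite le_measure ?inE//; exact: measurableU.
rewrite N0 add0e lebesgue_measure_itv/= lte01 sube0 => le1.
have le2 : mu (\bigcup_k A k) <= \sum_(k <oo) mu (A k).
  by apply: measure_sigma_subadditive.
have le3 : \sum_(k <oo) mu (A k) <= (2 * C)%:E * \sum_(k <oo) diameter_pow s (U k).
  rewrite -nneseriesZl; last by move=> k _; exact: diameter_pow_ge0.
  by apply: lee_nneseries => // k _; have [] := hA k.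
have le4 : (2 * C)%:E * \sum_(k <oo) diameter_pow s (U k) <= (2 * C)%:E * (4 * C)^-1%:E.
  by rewrite lee_pmul2l ?lte_fin ?mulr_gt0// ltW.
have := le_trans le1 (le_trans le2 (le_trans le3 le4)).
rewrite -EFinM lee_fin; apply/negP; rewrite -ltNge ltr_pdivrMr ?mulr_gt0//; lra.
Qed.

Lemma hausdorff_dim_eq1 E : mu.-negligible E ->
  (forall s, (0 <= s < 1)%R -> hausdorff_measure s E != 0) -> hausdorff_dim E = 1.
Proof.
move=> E0 Es; apply/eqP; rewrite eq_le; apply/andP; split.
  by apply: ereal_inf_lbound; exists 1%R => //; split => //; exact: hausdorff_measure1_negligible.
apply: le_ereal_inf_tmp => _ [s [s0 Hs] <-]; rewrite lee_fin leNgt; apply/negP => s1.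
by have := Es s; rewrite s0 s1 Hs eqxx => /(_ isT).
Qed.
End hausdorff.

(** * Numbers with forced zero digits *)

Section respell.
Variables (R : realType) (M B : nat).
Hypotheses (M2 : (2 <= M)%N) (MB : (M < B)%N).

Let B0 : (0 < B)%N. Proof. exact: leq_ltn_trans MB. Qed.
Let BR : 0 < B%:R :> R. Proof. by rewrite ltr0n. Qed.
Let B1 : 1 < B%:R :> R. Proof. by rewrite ltr1n (leq_trans M2)// ltnW. Qed.
Let MR : 0 < M%:R :> R. Proof. by rewrite ltr0n (leq_trans _ M2). Qed.

(** The base-M digits of u, read as base-B digits; the supremum is the limit of
    the increasing partial sums. *)
Definition respell (u : R) : R :=
  sup (range (fun p => value R B (prefix_digits M u p))).

(** The number all of whose base-B digits are M - 1. *)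
Definition tail_bound : R := (M%:R - 1) / (B%:R - 1).

Lemma tail_bound_ge0 : 0 <= tail_bound.
Proof. by rewrite divr_ge0 ?subr_ge0 ?ler1n ?(leq_trans _ M2)// ltW. Qed.

Lemma tail_bound_lt : tail_bound < M%:R / B%:R.
Proof.
rewrite ltr_pdivrMr ?subr_gt0// mulrAC ltr_pdivlMr//.
have : M%:R < B%:R :> R by rewrite ltr_nat.
lra.
Qed.

Lemma value_le_tail (w : seq nat) : all (gtn M) w -> 0 <= value R B w <= tail_bound.
Proof.
elim: w => [_|d w IH] /=; first by rewrite lexx tail_bound_ge0.
move=> /andP[dM /IH /andP[w0 w1]]; rewrite divr_ge0 ?addr_ge0//=.
rewrite ler_pdivrMr//.
have tb : tail_bound * B%:R = M%:R - 1 + tail_bound.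
  by rewrite /tail_bound; field; rewrite subr_eq0 gt_eqF.
have : d%:R + 1 <= M%:R :> R by rewrite natr1 ler_nat.
rewrite tb; lra.
Qed.

Let value_split (u : R) p q : (p <= q)%N -> exists v, all (gtn M) v /\
  prefix_digits M u q = prefix_digits M u p ++ v.
Proof.
move=> pq; exists [seq digit M u j | j <- iota p (q - p)]; split.
  by apply/allP => d /mapP[j _ ->]; exact: ltn_digit.
by rewrite /prefix_digits -map_cat -[in iota p _](add0n p) -iotaD subnKC.
Qed.

Lemma respell_itv (u : R) p :
  0 <= respell u - value R B (prefix_digits M u p) <= tail_bound / B%:R ^+ p.
Proof.
have ub : ubound (range (fun q => value R B (prefix_digits M u q)))
    (value R B (prefix_digits M u p) + tail_bound / B%:R ^+ p).
  move=> _ [q _ <-]; have Bp r : 0 < B%:R ^+ r :> R by rewrite exprn_gt0.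
  have [qp|/ltnW pq] := leqP q p.
    have [v [/value_le_tail/andP[v0 _] ->]] := value_split u qp.
    rewrite value_cat -addrA lerDl addr_ge0// divr_ge0 ?tail_bound_ge0 ?exprn_ge0//.
  have [v [/value_le_tail/andP[_ v1] ->]] := value_split u pq.
  by rewrite value_cat size_prefix_digits lerD2l ler_wpM2r// invr_ge0 ltW.
rewrite subr_ge0 lerBlDl; apply/andP; split.
  apply: ub_le_sup; last by exists p.
  by exists (value R B (prefix_digits M u p) + tail_bound / B%:R ^+ p).
by apply: ge_sup => //; exists (value R B (prefix_digits M u 0)), 0%N.
Qed.

Lemma respell_approx (u : R) p : `|respell u - value R B (prefix_digits M u p)| <= B%:R ^- p.
Proof.
have /andP[h0 h1] := respell_itv u p; rewrite ger0_norm//.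
apply: le_trans h1 _; rewrite ler_piMl ?invr_ge0 ?exprn_ge0//.
apply: ltW; apply: lt_trans tail_bound_lt _.
by rewrite ltr_pdivrMr// mul1r ltr_nat.
Qed.

Lemma tail_bound_gap : B%:R^-1 <= 1 - tail_bound.
Proof.
have B10 : 0 < B%:R - 1 :> R by rewrite subr_gt0.
have M1B : M%:R + 1 <= B%:R :> R by rewrite natr1 ler_nat.
rewrite -(ler_pM2r B10) mulrBl divfK ?gt_eqF// mulrBr mulVf ?gt_eqF//.
have : 0 < B%:R^-1 :> R by rewrite invr_gt0.
lra.
Qed.

(** A larger digit at the index i gains at least B ^ - (i + 1), of which the
    following digits cannot compensate more than the proportion [tail_bound]. *)
Lemma respell_separates (u v : R) i : prefix_digits M u i = prefix_digits M v i ->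
  digit M u i != digit M v i -> B%:R ^- i.+2 <= `|respell u - respell v|.
Proof.
move=> uv; wlog duv : u v uv / (digit M u i < digit M v i)%N.
  move=> W ne; have := ne; rewrite neq_ltn => /orP[h|h]; first exact: W.
  by rewrite distrC W// eq_sym.
move=> _.
have /andP[_ u1] := respell_itv u i.+1.
have /andP[v0 _] := respell_itv v i.+1.
move: u1 v0; rewrite !prefix_digitsS !value_cat !size_prefix_digits uv /= !addr0.
set V := value _ _ _; rewrite exprS invfM.
have Bi : 0 < B%:R ^- i :> R by rewrite invr_gt0 exprn_gt0.
have Bi1 : 0 < B%:R^-1 * B%:R ^- i :> R by rewrite mulr_gt0// invr_gt0.
move=> u1 v0.
have d1 : (digit M u i)%:R + 1 <= (digit M v i)%:R :> R by rewrite natr1 ler_nat.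
have step : ((digit M u i)%:R + 1) / B%:R / B%:R ^+ i <= (digit M v i)%:R / B%:R / B%:R ^+ i :> R.
  by rewrite -!mulrA ler_wpM2r// ltW.
have half := ler_wpM2r (ltW Bi1) tail_bound_gap.
rewrite distrC; apply: le_trans (ler_norm _).
rewrite !exprS !invfM; move: u1 v0 step half.
rewrite -!(mulrA _ B%:R^-1).
set e := B%:R^-1 * B%:R ^- i; rewrite !mulrDl !mul1r => u1 v0 step half.
lra.
Qed.

(** If i is the first index at which the digits differ then u and v are at
    distance at most M ^ - i and their images at least B ^ - (i + 2), and the
    power s of B is at most M. *)
Lemma respell_holder (s : R) : 0 <= s -> B%:R `^ s <= M%:R ->
  forall u v : R, 0 <= u < 1 -> 0 <= v < 1 ->
  `|u - v| <= M%:R ^+ 2 * `|respell u - respell v| `^ s.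
Proof.
move=> s0 sM u v u01 v01.
have fr (t : R) : 0 <= t < 1 -> frac_part t = t.
  by move=> h; rewrite (@frac_part_int _ _ 0) ?subr0// add0r.
have [same|] := pselect (forall i, digit M u i = digit M v i).
  suff -> : u = v by rewrite subrr normr0 mulr_ge0 ?exprn_ge0 ?powR_ge0.
  apply/eqP/negPn/negP => uv.
  have uv0 : 0 < `|u - v| by rewrite normr_gt0 subr_eq0.
  have [p hp] : exists p, M%:R ^- p < `|u - v|.
    exists (Num.truncn `|u - v|^-1).+1.
    rewrite invf_plt ?posrE ?exprn_gt0//; apply: lt_trans (truncnS_gt _) _.
    by rewrite -natrX ltr_nat ltn_expl.
  have pE : prefix_digits M u p = prefix_digits M v p by apply: eq_map => i.
  have := value_prefix_digits M2 u p; have := value_prefix_digits M2 v p.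
  rewrite pE !fr//; set V := value _ _ _ => /andP[a1 a2] /andP[b1 b2].
  by move: hp; apply/negP; rewrite -leNgt ler_norml; apply/andP; split; lra.
move=> /existsNP[i0 /eqP ne0].
have ex : exists i, digit M u i != digit M v i by exists i0.
case: (ex_minnP ex) => i ne imin.
have pE : prefix_digits M u i = prefix_digits M v i.
  apply/eq_in_map => j; rewrite mem_iota add0n => /andP[_ ji].
  by apply/eqP/negPn/negP => /imin; rewrite leqNgt ji.
have dist : `|u - v| <= M%:R ^- i.
  have := value_prefix_digits M2 u i; have := value_prefix_digits M2 v i.
  rewrite pE !fr//; set V := value _ _ _ => /andP[a1 a2] /andP[b1 b2].
  by rewrite ler_norml; apply/andP; split; lra.
apply: le_trans dist _.
have sep := respell_separates pE ne.
apply: (@le_trans _ _ (M%:R ^+ 2 * (B%:R ^- i.+2) `^ s)); last first.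
  rewrite ler_wpM2l ?exprn_ge0// ge0_ler_powR ?nnegrE// invr_ge0 exprn_ge0//.
have -> : (B%:R ^- i.+2) `^ s = (B%:R `^ s) ^- i.+2 :> R.
  by rewrite -[B%:R ^- _]powR_invn// powRAC powR_invn// powR_ge0.
rewrite ler_pdivlMr ?exprn_gt0 ?powR_gt0// mulrC ler_pdivrMr ?exprn_gt0//.
rewrite -exprD add2n.
by rewrite lerXn2r ?nnegrE ?powR_ge0.
Qed.
End respell.

Section digit_gap.
Variables (R : realType) (b k : nat).
Hypotheses (b2 : (2 <= b)%N) (k0 : (0 < k)%N).
Let M := (b ^ k)%N.
Let B := (b ^ k.+1)%N.

Let b0 : (0 < b)%N. Proof. exact: leq_trans b2. Qed.
Let M2 : (2 <= M)%N.
Proof. by rewrite /M (leq_trans b2)// -{1}(expn1 b) leq_pexp2l. Qed.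
Let MB : (M < B)%N. Proof. by rewrite /M /B ltn_exp2l. Qed.
Let bR : 0 < b%:R :> R. Proof. by rewrite ltr0n. Qed.
Let BR : 0 < B%:R :> R. Proof. by rewrite ltr0n expn_gt0 b0. Qed.

(** A base-B digit less than M = b^k has a zero in front when it is written with
    k + 1 digits in base b, and the following digits produce no carry. *)
Lemma digit_respell (u : R) i : digit b (respell M B u) (i * k.+1) = 0%N.
Proof.
have /andP[y0 y1] := respell_itv M2 MB u 0%N.
have tl := tail_bound_lt R M2 MB.
have MBb : M%:R / B%:R = b%:R^-1 :> R.
  by rewrite /M /B expnS natrM invfM mulrCA divff ?mulr1// pnatr_eq0 -lt0n expn_gt0 b0.
move: y0 y1; rewrite /= subr0 expr0 divr1 => y0 y1.
have b1 : b%:R^-1 <= 1 :> R by rewrite invf_le1// ler1n.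
have fy : frac_part (respell M B u) = respell M B u.
  rewrite (@frac_part_int _ _ 0) ?subr0// add0r y0/=.
  by rewrite (le_lt_trans y1)// (lt_le_trans tl)// MBb.
rewrite /digit fy exprS mulrCA mulnC exprM -natrX -/B.
have /andP[r0 r1] := respell_itv M2 MB u i.
have wB : all (gtn B) (prefix_digits M u i).
  by apply/allP => d /(allP (prefix_digits_lt M2 u i)) /= /ltn_trans; apply.
have [A _ AE] := value_nat R (leq_trans M2 (ltnW MB)) wB.
rewrite AE size_prefix_digits in r0 r1.
have Bi : 0 < B%:R ^+ i :> R by rewrite exprn_gt0.
have -> : Num.truncn (b%:R * (respell M B u * B%:R ^+ i)) = (b * A)%N; last by rewrite modnMr.
apply: truncn_def; rewrite -[(b * A).+1%:R]natr1 natrM.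
move: r0 r1; rewrite subr_ge0 ler_pdivrMr// lerBlDr -mulrDl ler_pdivlMr// => r0 r1.
have bt : b%:R * tail_bound R M B < 1 by rewrite mulrC -ltr_pdivlMr// div1r -MBb.
have := ler_wpM2l (ltW bR) r1; have := ler_wpM2l (ltW bR) r0.
by rewrite mulrDr => h0 h1; apply/andP; split; lra.
Qed.

Lemma respell_not_normal (u : R) : ~ normal b (respell M B u).
Proof.
pose w : seq 'I_b := nseq k.+1 (Ordinal b2).
move=> /(_ w).
have -> : (fun N => (occurrences (respell M B u) w N)%:R / N%:R : R) = cst 0.
  apply/funext => N; rewrite /occurrences (eq_count (_ : _ =1 pred0)) ?count_pred0 ?mul0r// => n.
  apply/negP => /eqP; rewrite /w size_nseq map_nseq => E.
  pose q := ((n + k) %/ k.+1)%N; pose j := (q * k.+1 - n)%N.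
  have [jk nj] : (j < k.+1)%N /\ (n + j = q * k.+1)%N.
    have := divn_eq (n + k) k.+1; have := ltn_pmod (n + k) (ltn0Sn k).
    by rewrite /j /q; clear; lia.
  have := congr1 (fun v => nth 0%N v j) E; cbv beta.
  by rewrite (nth_map 0%N) ?size_iota// nth_iota// add0n nj digit_respell nth_nseq jk.
move=> /(cvg_unique (@norm_hausdorff _ _) (cvg_cst _)) H.
have : 0 < b%:R ^- size w :> R by rewrite invr_gt0 exprn_gt0.
by rewrite -H ltxx.
Qed.
End digit_gap.

(** On [m, m + 1) one has gamma x = gamma m + gamma (x - m), and reading the
    binary digits of x - m as binary digits gives x - m back. *)
Lemma not_absolutely_normal_negligible (R : realType) (gamma : R) :
  irrational gamma ->
  (@lebesgue_measure R).-negligible [set x : R | ~ absolutely_normal (gamma * x)].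
Proof.
move=> irr.
pose E (m : int) := [set x : R | m%:~R <= x < m%:~R + 1 /\ ~ absolutely_normal (gamma * x)].
have E0 m : (@lebesgue_measure R).-negligible (E m).
  have fr (u : R) p : `|frac_part u - value R 2 (prefix_digits 2 u p)| <= 2%:R ^- p.
    have /andP[h0 h1] := value_prefix_digits (isT : (2 <= 2)%N) u p.
    by rewrite ger0_norm// ltW.
  have := absolutely_normal_ae m (isT : (2 <= 2)%N) (isT : (2 <= 2)%N) fr (gamma * m%:~R) irr.
  apply: negligibleS => u [um nu]; split => //=.
  by rewrite (frac_part_int um) -mulrDr addrC subrK.
have neg : (@lebesgue_measure R).-negligible (\bigcup_k (E (Posz k) `|` E (Negz k))).
  by apply: negligible_bigcup => k; exact: negligibleU.
apply: negligibleS neg => x nx.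
have xm : (Num.floor x)%:~R <= x < (Num.floor x)%:~R + 1.
  by have := floor_itv x; rewrite intrD.
by move: xm; case: (Num.floor x) => k xm; exists k => //; [left|right].
Qed.

Lemma irrationalV (R : realType) (gamma : R) : irrational gamma -> irrational gamma^-1.
Proof.
move=> irr [q _ E]; apply: irr; exists q^-1 => //.
by rewrite fmorphV/= E invrK.
Qed.

(** The numbers gamma^-1 * respell u are absolutely normal for almost every u,
    and multiplication by gamma returns respell u. *)
Lemma hausdorff_measure_respell (R : realType) (b : nat) (gamma s : R) (E : set R) :
  (2 <= b)%N -> irrational gamma -> 0 <= s < 1 ->
  (forall x, absolutely_normal x -> ~ normal b (gamma * x) -> E x) ->
  hausdorff_measure s E != 0%E.
Proof.
move=> b2 irr /andP[s0 s1] EP.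
have g0 : gamma != 0.
  by apply/eqP => g0; apply: irr; exists 0 => //; rewrite g0 rmorph0.
have th0 : 0 < `|gamma^-1| by rewrite normr_gt0 invr_eq0.
(* s <= k / (k + 1), the dimension of the set of numbers produced by respell. *)
pose k := (Num.truncn (s / (1 - s))).+1.
have ks : s * k.+1%:R <= k%:R.
  have h : s / (1 - s) < k%:R by exact: truncnS_gt.
  move: h; rewrite ltr_pdivrMr ?subr_gt0// -[k.+1%:R]natr1; lra.
have k0 : (0 < k)%N by [].
clearbody k.
pose M := (b ^ k)%N; pose B := (b ^ k.+1)%N.
have b1 : 1 <= b%:R :> R by rewrite ler1n ltnW.
have M2 : (2 <= M)%N by rewrite /M (leq_trans b2)// -{1}(expn1 b) leq_pexp2l// ltnW.
have MB : (M < B)%N by rewrite /M /B ltn_exp2l.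
have BM : B%:R `^ s <= M%:R :> R.
  rewrite /B /M !natrX -!powR_mulrn ?(le_trans ler01)// -powRrM.
  by rewrite ler_powR// mulrC.
have irr' := irrationalV irr.
pose C : R := M%:R ^+ 2 / `|gamma^-1| `^ s.
have M0 : 0 < M%:R :> R by rewrite ltr0n (leq_trans _ M2).
have C0 : 0 < C by rewrite divr_gt0 ?exprn_gt0 ?powR_gt0.
apply: (@hausdorff_measure_holder _ s C (fun u => gamma^-1 * respell M B u)
   [set u | absolutely_normal (gamma^-1 * respell M B u)]) => //.
- move=> u v u01 v01; apply: le_trans (respell_holder M2 MB s0 BM u01 v01) _.
  by rewrite -mulrBr normrM powRM// /C mulrA divfK// gt_eqF// powR_gt0.
- have := absolutely_normal_ae 0 M2 (leq_trans M2 (ltnW MB)) (respell_approx M2 MB) 0 irr'.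
  by apply: negligibleS => u [u01 nu]; split => /=; rewrite add0r.
- move=> u _ Gu; apply: EP => //.
  rewrite mulrA mulfV// mul1r; exact: respell_not_normal.
Qed.

Theorem corollary2p6 (R : realType) (b : nat) (hb : (2 <= b)%N)
    (gamma : R) (hgamma : irrational gamma) :
  let E_gamma_b := [set x : R | normal b x /\ ~ normal b (gamma * x)] in
  let E_gamma :=
    [set x : R | absolutely_normal x /\ ~ absolutely_normal (gamma * x)] in
  [/\ hausdorff_dim E_gamma_b = 1%E,
      (@lebesgue_measure R).-negligible E_gamma_b,
      hausdorff_dim E_gamma = 1%E &
      (@lebesgue_measure R).-negligible E_gamma].
Proof.
move=> E_gamma_b E_gamma.
have null := not_absolutely_normal_negligible hgamma.
have null_b : (@lebesgue_measure R).-negligible E_gamma_b.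
  apply: negligibleS null => x [_ nx] /= an; apply: nx; exact: an.
have null_g : (@lebesgue_measure R).-negligible E_gamma.
  by apply: negligibleS null => x [].
split => //.
- apply: hausdorff_dim_eq1 => // s s01.
  by apply: (hausdorff_measure_respell hb hgamma s01) => x an nx; split => //; exact: an.
- apply: hausdorff_dim_eq1 => // s s01.
  apply: (hausdorff_measure_respell hb hgamma s01) => x an nx; split => // an'.
  by apply: nx; exact: an'.
Qed.
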